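(* Let $X$ be a real Hilbert space and let $f,g\in\Gamma_0(X)$. Let $T:=\operatorname{Id}-\operatorname{P}_f+\operatorname{P}_g\operatorname{R}_f$ and $v:=P_{\overline{\operatorname{ran}}(\operatorname{Id}-T)}(0)$. Assume that $\overline{\operatorname{ran}}(\operatorname{Id}-T)=\overline{D\cap R}=\overline{D}\cap\overline{R}$, where $D:=\operatorname{dom}\partial f-\operatorname{dom}\partial g$ and $R:=\operatorname{ran}\partial f+\operatorname{ran}\partial g$. Suppose that $0\in\operatorname{dom}f^*+\operatorname{dom}g^*$, that $v\in\operatorname{ran}(\operatorname{Id}-T)$, and that $\operatorname{zer}(\partial f+\partial g(\cdot-v))\neq\varnothing$. Set $\mu:=\min_{y\in X}\big(f(y)+g(y-v)\big)$. Let $x\in X$. Then there exists $\overline{z}\in X$ such that: (i) $\operatorname{P}_fT^nx\rightharpoonup\overline{z}$ (weakly) and $\overline{z}$ is a minimizer of $f+g(\cdot-v)$; (ii) $\operatorname{P}_g\operatorname{R}_fT^nx\rightharpoonup\overline{z}-v$ and $\overline{z}-v$ is a minimizer of $f(\cdot+v)+g$; (iii) $f(\operatorname{P}_fT^nx)+g(\operatorname{P}_g\operatorname{R}_fT^nx)\to f(\overline{z})+g(\overline{z}-v)=\mu$; (iv) $f(\operatorname{P}_fT^nx)\to f(\overline{z})$; (v) $g(\operatorname{P}_g\operatorname{R}_fT^nx)\to g(\overline{z}-v)$.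
   Context: $\Gamma_0(X)$ denotes the set of convex, lower semicontinuous, proper functions $X\to\left]-\infty,+\infty\right]$. For $h\in\Gamma_0(X)$, $\operatorname{P}_h:=\operatorname{Prox}_h=(\operatorname{Id}+\partial h)^{-1}$ is the proximal mapping and $\operatorname{R}_h:=2\operatorname{P}_h-\operatorname{Id}$. $f^*$ denotes the Fenchel conjugate. $P_C$ denotes the metric projection onto a nonempty closed convex set $C$; $\overline{\operatorname{ran}}$ denotes the closure of the range. $\operatorname{zer}M=M^{-1}(0)$. $T^n$ is the $n$-th iterate of $T$. *)

(* Defs.v *)
From Stdlib Require Import Reals ClassicalEpsilon.
From Coquelicot Require Import Coquelicot.
Open Scope R_scope.

Record Hilbert := MkHilbert {
  hcar :> Type;
  hzero : hcar;
  hadd : hcar -> hcar -> hcar;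
  hopp : hcar -> hcar;
  hscal : R -> hcar -> hcar;
  hinner : hcar -> hcar -> R;
  hadd_assoc : forall x y z, hadd x (hadd y z) = hadd (hadd x y) z;
  hadd_comm : forall x y, hadd x y = hadd y x;
  hadd_0 : forall x, hadd x hzero = x;
  hadd_opp : forall x, hadd x (hopp x) = hzero;
  hscal_assoc : forall a b x, hscal a (hscal b x) = hscal (a * b) x;
  hscal_1 : forall x, hscal 1 x = x;
  hscal_distr_l : forall a x y, hscal a (hadd x y) = hadd (hscal a x) (hscal a y);
  hscal_distr_r : forall a b x, hscal (a + b) x = hadd (hscal a x) (hscal b x);
  hinner_sym : forall x y, hinner x y = hinner y x;
  hinner_add_l : forall x y z, hinner (hadd x y) z = hinner x z + hinner y z;
  hinner_scal_l : forall a x y, hinner (hscal a x) y = a * hinner x y;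
  hinner_pos : forall x, 0 <= hinner x x;
  hinner_def : forall x, hinner x x = 0 -> x = hzero;
  hcomplete : forall u : nat -> hcar,
    (forall eps, 0 < eps -> exists N, forall m n, (N <= m)%nat -> (N <= n)%nat ->
        sqrt (hinner (hadd (u m) (hopp (u n))) (hadd (u m) (hopp (u n)))) < eps) ->
    exists l, forall eps, 0 < eps -> exists N, forall n, (N <= n)%nat ->
        sqrt (hinner (hadd (u n) (hopp l)) (hadd (u n) (hopp l))) < eps
}.

Arguments hzero {h}.
Arguments hadd {h}.
Arguments hopp {h}.
Arguments hscal {h}.
Arguments hinner {h}.

Section HilbertDefs.
Variable X : Hilbert.

Definition hsub (x y : X) : X := hadd x (hopp y).
Definition hnorm (x : X) : R := sqrt (hinner x x).

Definition strong_cvg (u : nat -> X) (l : X) : Prop :=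
  forall eps, 0 < eps -> exists N, forall n, (N <= n)%nat -> hnorm (hsub (u n) l) < eps.
Definition weak_cvg (u : nat -> X) (l : X) : Prop :=
  forall y : X, is_lim_seq (fun n => hinner (u n) y) (hinner l y).

Definition dom (h : X -> Rbar) (x : X) : Prop := h x <> p_infty.
Definition proper (h : X -> Rbar) : Prop :=
  (forall x, h x <> m_infty) /\ exists x, dom h x.
Definition convex (h : X -> Rbar) : Prop :=
  forall x y (a b t : R), 0 <= t <= 1 ->
    Rbar_le (h x) a -> Rbar_le (h y) b ->
    Rbar_le (h (hadd (hscal t x) (hscal (1 - t) y))) (t * a + (1 - t) * b).
Definition lsc (h : X -> Rbar) : Prop :=
  forall (a : R) (u : nat -> X) (x : X),
    (forall n, Rbar_le (h (u n)) a) -> strong_cvg u x -> Rbar_le (h x) a.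
Definition Gamma0 (h : X -> Rbar) : Prop := convex h /\ lsc h /\ proper h.

Definition fconj (h : X -> Rbar) (u : X) : Rbar :=
  Lub_Rbar (fun r => exists x fx, h x = Finite fx /\ r = hinner u x - fx).

Definition subdiff (h : X -> Rbar) (x u : X) : Prop :=
  exists hx : R, h x = Finite hx /\
    forall y, Rbar_le (hx + hinner u (hsub y x)) (h y).
Definition dom_subdiff (h : X -> Rbar) (x : X) : Prop := exists u, subdiff h x u.
Definition ran_subdiff (h : X -> Rbar) (u : X) : Prop := exists x, subdiff h x u.

(* proximal mapping P_h = (Id + dh)^{-1} and reflected resolvent R_h *)
Definition prox (h : X -> Rbar) (x : X) : X :=
  epsilon (inhabits hzero) (fun p => subdiff h p (hsub x p)).
Definition refl (h : X -> Rbar) (x : X) : X := hsub (hscal 2 (prox h x)) x.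

Definition closure (S : X -> Prop) (y : X) : Prop :=
  forall eps, 0 < eps -> exists s, S s /\ hnorm (hsub y s) < eps.

Definition is_proj0 (C : X -> Prop) (v : X) : Prop :=
  C v /\ forall w, C w -> hnorm v <= hnorm w.

Definition is_minimizer (F : X -> Rbar) (z : X) : Prop :=
  forall y, Rbar_le (F z) (F y).

End HilbertDefs.

Arguments hsub {X}.
Arguments hnorm {X}.
Arguments strong_cvg {X}.
Arguments weak_cvg {X}.
Arguments dom {X}.
Arguments Gamma0 {X}.
Arguments fconj {X}.
Arguments subdiff {X}.
Arguments dom_subdiff {X}.
Arguments ran_subdiff {X}.
Arguments prox {X}.
Arguments refl {X}.
Arguments closure {X}.
Arguments is_proj0 {X}.
Arguments is_minimizer {X}.

Definition Top {X : Hilbert} (f g : X -> Rbar) (x : X) : X :=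
  hadd (hsub x (prox f x)) (prox g (refl f x)).

Definition Rbar_cvg (u : nat -> Rbar) (l : Rbar) : Prop :=
  match l with
  | Finite r => forall eps, 0 < eps -> exists N, forall n, (N <= n)%nat ->
                  exists un, u n = Finite un /\ Rabs (un - r) < eps
  | p_infty => forall M : R, exists N, forall n, (N <= n)%nat -> Rbar_lt M (u n)
  | m_infty => forall M : R, exists N, forall n, (N <= n)%nat -> Rbar_lt (u n) M
  end.

(* Main.v *)
(** Write [x_n = T^n x], [p_n = P_f x_n], [q_n = P_g R_f x_n], [d_n = p_n - q_n - v] and
    [k_n = x_n + n v - p_n].  The two range conditions force [v] to be the least-norm
    point of the closure of [dom f - dom g], so [<a - b, v> >= |v|^2] on
    [dom f * dom g].  Hence the terms carrying the unbounded factor [n] in the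
    subgradient inequalities at [p_n] and [q_n] have a favourable sign.  Consequently
    [p_n + k_n] is Fejer monotone with respect to the sums [z + u] of primal and dual
    solutions, [d_n -> 0], and [f(p_n) + g(q_n) -> mu].  For primal solutions [a], [b] the
    numbers [<k_n, a - b>] converge, hence so do [<p_n, a - b>].  Since every
    closed convex cluster point of a subsequence of [p_n] is a primal solution, there
    is only one, and [p_n] converges weakly to it. *)
Require Import Defs.
From Stdlib Require Import Reals Lra Lia Classical ClassicalEpsilon.
From Coquelicot Require Import Coquelicot.
Open Scope R_scope.

(** * Inner product calculus *)

(** If [v] is nonzero, [T] has no fixed point and [x_n] drifts away; adding [n v] back gives
    [p_n + k_n]. Fejer monotonicity controls only this sum, whereas the claim concerns [p_n].
    Comparing squared distances to [a + u] and [b + u], with one and the same dual solution [u],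
    shows that [<p_n + k_n, a - b>] converges; function values supply the limit of [<k_n, a - b>]
    separately, namely [f a - f b]. For two cluster points [c] and [z], taking [a = c] and [b = z]
    gives [<c, c - z> = <z, c - z>], so [c = z]: testing against differences of solutions is
    enough. *)

Definition nsq {X : Hilbert} (x : X) : R := hinner x x.

Section Algebra.
Context {X : Hilbert}.
Implicit Types x y z w : X.

Lemma hinner_zero_l w : hinner hzero w = 0.
Proof.
  assert (H := hinner_add_l X hzero hzero w).
  rewrite hadd_0 in H. lra.
Qed.

Lemma hinner_opp_l x w : hinner (hopp x) w = - hinner x w.
Proof.
  assert (H := hinner_add_l X x (hopp x) w).
  rewrite hadd_opp, hinner_zero_l in H. lra.
Qed.

Lemma hinner_zero_r w : hinner w hzero = 0.
Proof. rewrite hinner_sym. apply hinner_zero_l. Qed.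

Lemma hinner_opp_r x w : hinner w (hopp x) = - hinner w x.
Proof. rewrite hinner_sym, hinner_opp_l, hinner_sym. reflexivity. Qed.

Lemma hinner_add_r x y w : hinner w (hadd x y) = hinner w x + hinner w y.
Proof.
  rewrite hinner_sym, hinner_add_l, (hinner_sym X x), (hinner_sym X y). reflexivity.
Qed.

Lemma hinner_scal_r a x w : hinner w (hscal a x) = a * hinner w x.
Proof. rewrite hinner_sym, hinner_scal_l, hinner_sym. reflexivity. Qed.

Lemma hinner_sub_l x y w : hinner (hsub x y) w = hinner x w - hinner y w.
Proof. unfold hsub. rewrite hinner_add_l, hinner_opp_l. ring. Qed.

Lemma hinner_sub_r x y w : hinner w (hsub x y) = hinner w x - hinner w y.
Proof. unfold hsub. rewrite hinner_add_r, hinner_opp_r. ring. Qed.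

Lemma eq_of_nsq_hsub_le0 x y : nsq (hsub x y) <= 0 -> x = y.
Proof.
  intros H.
  assert (E : hsub x y = hzero).
  { apply hinner_def. apply Rle_antisym; [exact H | apply hinner_pos]. }
  unfold hsub in E.
  rewrite <- (hadd_0 X x), <- (hadd_opp X y), (hadd_comm X y), hadd_assoc, E.
  rewrite hadd_comm, hadd_0. reflexivity.
Qed.

Lemma hilbert_ext x y : (forall w, hinner x w = hinner y w) -> x = y.
Proof.
  intros H. apply eq_of_nsq_hsub_le0. unfold nsq.
  rewrite hinner_sub_l, H. right. ring.
Qed.

End Algebra.

Ltac hexpand := unfold nsq;
  repeat first [ rewrite hinner_sub_l | rewrite hinner_sub_r
    | rewrite hinner_add_l | rewrite hinner_add_r
    | rewrite hinner_opp_l | rewrite hinner_opp_r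
    | rewrite hinner_scal_l | rewrite hinner_scal_r
    | rewrite hinner_zero_l | rewrite hinner_zero_r ].
(** Merges [<a, b>] and [<b, a>] into one atom, so that [ring] and [lra] can treat inner products as
    variables. *)
Ltac hsymm :=
  repeat match goal with
  | |- context [@hinner ?X ?a ?b] =>
      match goal with
      | |- context [@hinner X b a] =>
          tryif constr_eq a b then fail else rewrite (@hinner_sym X b a)
      end
  end.
Ltac hvec := apply hilbert_ext; intro; hexpand; try ring.
Ltac hring := hexpand; hsymm; ring.

(** * Norms, closures and convex sets *)

Section Norms.
Context {X : Hilbert}.
Implicit Types x y z w : X.

Lemma nsq_ge0 x : 0 <= nsq x.
Proof. apply hinner_pos. Qed.

Lemma hnorm_ge0 x : 0 <= hnorm x.
Proof. apply sqrt_pos. Qed.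

Lemma hnorm_sq x : hnorm x * hnorm x = nsq x.
Proof. apply sqrt_sqrt, hinner_pos. Qed.

Lemma hnorm_lt x eps : 0 < eps -> (hnorm x < eps <-> nsq x < eps * eps).
Proof.
  intros He. rewrite <- hnorm_sq. pose proof (hnorm_ge0 x). split; intros; nra.
Qed.

Lemma hnorm_le x y : hnorm x <= hnorm y <-> nsq x <= nsq y.
Proof.
  rewrite <- !hnorm_sq. pose proof (hnorm_ge0 x). pose proof (hnorm_ge0 y).
  split; intros; nra.
Qed.

Lemma cauchy_schwarz x y : Rabs (hinner x y) <= hnorm x * hnorm y.
Proof.
  assert (H : forall t, 0 <= nsq x + 2 * t * hinner x y + t * t * nsq y).
  { intros t. replace (_ + _) with (nsq (hadd x (hscal t y))) by hring. apply nsq_ge0. }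
  assert (S : hinner x y * hinner x y <= nsq x * nsq y).
  { destruct (Req_dec (nsq y) 0) as [Z|Z].
    - assert (hinner x y = 0); [|nra].
      apply NNPP; intros N.
      (* For [nsq y = 0] the quadratic is affine in [t], and this [t] gives it the value [-1]. *)
      specialize (H (- (nsq x + 1) / (2 * hinner x y))).
      rewrite Z in H.
      replace (2 * (- (nsq x + 1) / (2 * hinner x y)) * hinner x y)
        with (- (nsq x + 1)) in H by (field; auto). lra.
    - pose proof (nsq_ge0 y). specialize (H (- hinner x y / nsq y)).
      replace (nsq x + _ + _) with (nsq x - hinner x y * hinner x y / nsq y) in H
        by (field; auto).
      assert (hinner x y * hinner x y / nsq y <= nsq x) by lra.
      apply Rmult_le_compat_r with (r := nsq y) in H1; [|lra].
      unfold Rdiv in H1. rewrite Rmult_assoc, Rinv_l, Rmult_1_r in H1; auto. }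
  rewrite <- !hnorm_sq in S.
  pose proof (hnorm_ge0 x). pose proof (hnorm_ge0 y).
  assert (0 <= hnorm x * hnorm y) by nra.
  apply Rabs_le. split; nra.
Qed.

Lemma young x y t : 0 < t -> 2 * hinner x y <= t * nsq x + nsq y / t.
Proof.
  intros Ht.
  assert (H := nsq_ge0 (hsub (hscal t x) y)).
  replace (nsq _) with (t * (t * nsq x + nsq y / t - 2 * hinner x y)) in H.
  - nra.
  - unfold nsq, Rdiv. hexpand. hsymm. field. lra.
Qed.

Lemma nsq_convex x y t : 0 <= t <= 1 ->
  nsq (hadd (hscal t x) (hscal (1 - t) y)) <= t * nsq x + (1 - t) * nsq y.
Proof.
  intros Ht. pose proof (nsq_ge0 (hsub x y)).
  replace (nsq (hadd _ _))
    with (t * nsq x + (1 - t) * nsq y - t * (1 - t) * nsq (hsub x y)) by hring.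
  assert (0 <= t * (1 - t)) by nra. nra.
Qed.

Lemma nsq_sub_sym x y : nsq (hsub x y) = nsq (hsub y x).
Proof. hring. Qed.

Lemma nsq_triangle x y z : nsq (hsub x z) <= 2 * nsq (hsub x y) + 2 * nsq (hsub y z).
Proof.
  pose proof (nsq_ge0 (hsub (hsub x y) (hsub y z))).
  replace (nsq (hsub x z)) with
    (2 * nsq (hsub x y) + 2 * nsq (hsub y z) - nsq (hsub (hsub x y) (hsub y z))) by hring.
  lra.
Qed.

Lemma closure_nsq (S : X -> Prop) y :
  closure S y <-> forall eps, 0 < eps -> exists s, S s /\ nsq (hsub y s) < eps.
Proof.
  split.
  - intros H eps He. destruct (H (sqrt eps)) as [s [Hs L]]; [apply sqrt_lt_R0; auto|].
    exists s. split; auto. apply hnorm_lt in L; [|apply sqrt_lt_R0; auto].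
    rewrite sqrt_sqrt in L; lra.
  - intros H eps He. destruct (H (eps * eps)) as [s [Hs L]]; [nra|].
    exists s. split; auto. apply hnorm_lt; auto.
Qed.

Lemma closure_mono (S S' : X -> Prop) y :
  (forall s, S s -> S' s) -> closure S y -> closure S' y.
Proof. intros H C eps He. destruct (C eps He) as [s [? ?]]. exists s; auto. Qed.

Lemma closure_incl (S : X -> Prop) y : S y -> closure S y.
Proof.
  intros H. apply closure_nsq. intros eps He. exists y. split; auto.
  replace (nsq _) with 0 by hring. auto.
Qed.

Lemma closure_closure (S : X -> Prop) y : closure (closure S) y -> closure S y.
Proof.
  rewrite !closure_nsq. intros H eps He.
  destruct (H (eps / 4)) as [s [Hs L]]; [lra|].
  rewrite closure_nsq in Hs. destruct (Hs (eps / 4)) as [s' [Hs' L']]; [lra|].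
  exists s'. split; auto. pose proof (nsq_triangle y s s'). lra.
Qed.

Definition convex_set (C : X -> Prop) : Prop :=
  forall x y t, 0 <= t <= 1 -> C x -> C y -> C (hadd (hscal t x) (hscal (1 - t) y)).

Lemma closure_convex (C : X -> Prop) : convex_set C -> convex_set (closure C).
Proof.
  intros HC x y t Ht. rewrite !closure_nsq. intros Hx Hy eps He.
  destruct (Hx eps He) as [x' [Cx Lx]]. destruct (Hy eps He) as [y' [Cy Ly]].
  exists (hadd (hscal t x') (hscal (1 - t) y')). split; [apply HC; auto|].
  replace (hsub _ _) with (hadd (hscal t (hsub x x')) (hscal (1 - t) (hsub y y')))
    by hvec.
  eapply Rle_lt_trans; [apply nsq_convex; auto|].
  pose proof (Rmax_l (nsq (hsub x x')) (nsq (hsub y y'))).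
  pose proof (Rmax_r (nsq (hsub x x')) (nsq (hsub y y'))).
  pose proof (Rmax_lub_lt _ _ _ Lx Ly). nra.
Qed.

Lemma closure_halfspace (C : X -> Prop) w s c :
  (forall x, C x -> s <= hinner x w) -> closure C c -> s <= hinner c w.
Proof.
  intros H Hc. apply Rnot_lt_le. intros L.
  pose proof (hnorm_ge0 w).
  destruct (Hc ((s - hinner c w) / (hnorm w + 1))) as [x [Cx Lx]].
  { apply Rdiv_lt_0_compat; lra. }
  specialize (H x Cx).
  pose proof (cauchy_schwarz (hsub c x) w) as CS.
  rewrite hinner_sub_l in CS.
  pose proof (Rle_abs (- (hinner c w - hinner x w))) as A. rewrite Rabs_Ropp in A.
  apply Rmult_lt_compat_r with (r := hnorm w + 1) in Lx; [|lra].
  unfold Rdiv in Lx. rewrite Rmult_assoc, Rinv_l, Rmult_1_r in Lx; [|lra].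
  pose proof (hnorm_ge0 (hsub c x)). nra.
Qed.

(** On [C], [|x - c|^2 >= 0] yields the half-space [2 <x, c> <= r + |c|^2]; at [c] itself this says
    [|c|^2 <= r]. *)
Lemma closure_ball (C : X -> Prop) r c :
  (forall x, C x -> nsq x <= r) -> closure C c -> nsq c <= r.
Proof.
  intros H Hc.
  assert (L : forall x, C x -> - ((r + nsq c) / 2) <= hinner x (hopp c)).
  { intros x Cx. specialize (H x Cx). pose proof (nsq_ge0 (hsub x c)) as P.
    revert H P. hexpand. hsymm. intros. lra. }
  assert (Q := closure_halfspace C (hopp c) _ c L Hc).
  revert Q. hexpand. intros. lra.
Qed.

Lemma nsq_hadd_hsub_le (x y x' y' : X) :
  nsq (hsub (hadd x y) (hadd x' y')) <= 2 * nsq (hsub x x') + 2 * nsq (hsub y y').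
Proof.
  pose proof (nsq_ge0 (hsub (hsub x x') (hsub y y'))) as P.
  revert P. hexpand. hsymm. intros. lra.
Qed.

Lemma infimum (E : R -> Prop) (b : R) :
  (exists r, E r) -> (forall r, E r -> b <= r) ->
  exists m, (forall r, E r -> m <= r) /\ forall eps, 0 < eps -> exists r, E r /\ r < m + eps.
Proof.
  intros [r0 H0] Hb.
  destruct (completeness (fun s => E (- s))) as [m [U L]].
  - exists (- b). intros s Hs. specialize (Hb _ Hs). lra.
  - exists (- r0). rewrite Ropp_involutive. auto.
  - exists (- m). split.
    + intros r Hr. specialize (U (- r)). cbv beta in U.
      rewrite Ropp_involutive in U. specialize (U Hr). lra.
    + intros eps He. apply NNPP. intros N.
      assert (m <= m - eps); [|lra].
      apply L. intros s Hs. apply Rnot_lt_le. intros Ls. apply N.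
      exists (- s). split; auto. lra.
Qed.

Lemma inv_INR_pos n : 0 < / (INR n + 1).
Proof. apply Rinv_0_lt_compat. pose proof (pos_INR n). lra. Qed.

Lemma inv_INR_small eps : 0 < eps ->
  exists N, forall n, (N <= n)%nat -> / (INR n + 1) < eps.
Proof.
  intros He. destruct (INR_archimed 1 (/ eps)) as [N HN]; [lra|].
  exists N. intros n Hn. apply le_INR in Hn.
  rewrite <- (Rinv_inv eps). apply Rinv_lt_contravar; [|lra].
  assert (0 < / eps) by (apply Rinv_0_lt_compat; auto). nra.
Qed.

(* Almost-minimal-norm points of the sets form a Cauchy sequence, by the
   parallelogram law; this stands in for weak compactness throughout. *)
Lemma nested_closures (C : nat -> X -> Prop) (B : R) :
  (forall n, exists x, C n x) -> (forall n, convex_set (C n)) ->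
  (forall m n x, (m <= n)%nat -> C n x -> C m x) ->
  (forall n x, C n x -> nsq x <= B) ->
  exists c, forall n, closure (C n) c.
Proof.
  intros Hne Hcv Hdec HB.
  assert (HI : forall n, exists d, (forall x, C n x -> d <= nsq x) /\
      forall eps, 0 < eps -> exists x, C n x /\ nsq x < d + eps).
  { intros n. destruct (infimum (fun r => exists x, C n x /\ r = nsq x) 0) as [d [L A]].
    - destruct (Hne n) as [x Hx]. exists (nsq x), x. auto.
    - intros r [x [_ ->]]. apply nsq_ge0.
    - exists d. split.
      + intros x Hx. apply L. exists x. auto.
      + intros eps He. destruct (A eps He) as [r [[x [Hx ->]] Lr]]. exists x. auto. }
  set (d := fun n => proj1_sig (constructive_indefinite_description _ (HI n))).
  assert (Hd : forall n, (forall x, C n x -> d n <= nsq x) /\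
      forall eps, 0 < eps -> exists x, C n x /\ nsq x < d n + eps)
    by (intros n; exact (proj2_sig (constructive_indefinite_description _ (HI n)))).
  clearbody d.
  assert (HU : forall n, exists x, C n x /\ nsq x < d n + / (INR n + 1)).
  { intros n. apply Hd, inv_INR_pos. }
  set (u := fun n => proj1_sig (constructive_indefinite_description _ (HU n))).
  assert (Hu : forall n, C n (u n) /\ nsq (u n) < d n + / (INR n + 1))
    by (intros n; exact (proj2_sig (constructive_indefinite_description _ (HU n)))).
  clearbody u.
  destruct (completeness (fun r => exists n, r = d n)) as [D [DU DL]].
  - exists B. intros r [n ->]. destruct (Hne n) as [x Hx].
    apply Rle_trans with (nsq x); [apply Hd; auto | eapply HB; eauto].
  - exists (d 0%nat), 0%nat. auto.
  - assert (HC : forall eps, 0 < eps -> exists N, forall m n, (N <= m)%nat -> (N <= n)%nat ->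
        nsq (hsub (u m) (u n)) < eps).
    { intros eps He.
      (* The midpoint of [u m] and [u n] lies in [C N0], so its squared norm exceeds [D - eps / 8],
         while [u m] and [u n] have squared norms below [D + eps / 8]. The parallelogram law adds
         these up to [eps]. *)
      assert (exists N0, D - eps / 8 < d N0) as [N0 H0].
      { apply NNPP. intros N. assert (D <= D - eps / 8); [|lra].
        apply DL. intros r [n ->]. apply Rnot_lt_le. intros L. apply N. exists n. auto. }
      destruct (inv_INR_small (eps / 8)) as [N1 H1]; [lra|].
      exists (max N0 N1). intros m n Hm Hn.
      destruct (Hu m) as [Cm Lm]. destruct (Hu n) as [Cn Ln].
      assert (Im := H1 m ltac:(lia)). assert (In := H1 n ltac:(lia)).
      assert (Dm : d m <= D) by (apply DU; eauto).
      assert (Dn : d n <= D) by (apply DU; eauto).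
      assert (M : d N0 <= nsq (hadd (hscal (1/2) (u m)) (hscal (1 - 1/2) (u n)))).
      { apply Hd. apply Hcv; [lra | apply Hdec with m | apply Hdec with n]; auto; lia. }
      replace (nsq (hsub (u m) (u n))) with (2 * nsq (u m) + 2 * nsq (u n)
        - 4 * nsq (hadd (hscal (1/2) (u m)) (hscal (1 - 1/2) (u n))))
        by (hexpand; hsymm; field).
      lra. }
    destruct (hcomplete X u) as [l Hl].
    + intros eps He. destruct (HC (eps * eps)) as [N HN]; [nra|].
      exists N. intros m n Hm Hn.
      apply (proj2 (hnorm_lt (hsub (u m) (u n)) eps He)). auto.
    + exists l. intros n eps He. destruct (Hl eps He) as [N HN].
      exists (u (max n N)). split.
      * eapply Hdec; [|apply Hu]. lia.
      * assert (E := HN (max n N) ltac:(lia)).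
        apply (proj1 (hnorm_lt (hsub (u (max n N)) l) _ He)) in E.
        rewrite nsq_sub_sym in E. apply hnorm_lt; auto.
Qed.

(** Quantitative continuity of [|. - y|^2] at [c], needed to carry the quadratic term of the
    proximal objective through a closure. *)
Lemma nsq_approx (c s y : X) t : 0 < t ->
  nsq (hsub c y) <= nsq (hsub s y) + t * nsq (hsub c y) + nsq (hsub c s) / t.
Proof.
  intros Ht. pose proof (young (hsub c y) (hsub c s) t Ht) as Y.
  pose proof (nsq_ge0 (hsub c s)).
  assert (E : nsq (hsub s y)
    = nsq (hsub c y) - 2 * hinner (hsub c y) (hsub c s) + nsq (hsub c s)) by hring.
  lra.
Qed.

(** First-order optimality along a segment: divide by [t] and let [t] tend to 0. It serves both the
    projection and the proximal point. *)
Lemma le_of_affine_quadratic (a b : R) :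
  (forall t, 0 < t <= 1 -> 0 <= a * t + b * (t * t)) -> 0 <= a.
Proof.
  intros H. apply Rnot_lt_le. intros La.
  pose proof (Rle_abs b). pose proof (Rabs_pos b).
  set (t := Rmin 1 (- a / (2 * (Rabs b + 1)))).
  assert (T0 : 0 < - a / (2 * (Rabs b + 1))) by (apply Rdiv_lt_0_compat; lra).
  assert (T : 0 < t <= 1).
  { unfold t. split; [apply Rmin_glb_lt; lra | apply Rmin_l]. }
  assert (T2 : t * (2 * (Rabs b + 1)) <= - a).
  { replace (- a) with (- a / (2 * (Rabs b + 1)) * (2 * (Rabs b + 1))) by (field; lra).
    apply Rmult_le_compat_r; [lra | apply Rmin_r]. }
  specialize (H t T). assert (b * t <= - a / 2) by nra. nra.
Qed.

Lemma min_norm (C : X -> Prop) : convex_set C -> (exists x, C x) ->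
  exists v, closure C v /\ forall w, C w -> nsq v <= hinner w v.
Proof.
  intros HC [x0 Hx0].
  destruct (infimum (fun r => exists x, closure C x /\ r = nsq x) 0) as [d [L A]].
  { exists (nsq x0), x0. split; auto. apply closure_incl; auto. }
  { intros r [x [_ ->]]. apply nsq_ge0. }
  (* Any common closure point of these almost-minimal sets attains the infimum [d], by
     [closure_ball]. *)
  destruct (nested_closures (fun n x => closure C x /\ nsq x <= d + / (INR n + 1)) (d + 1))
    as [v Hv].
  - intros n. destruct (A _ (inv_INR_pos n)) as [r [[x [Hx ->]] Lr]].
    exists x. split; auto. lra.
  - intros n x y t Ht [Cx Lx] [Cy Ly]. split; [apply closure_convex; auto|].
    eapply Rle_trans; [apply nsq_convex; auto|]. nra.
  - intros m n x Hmn [Cx Lx]. split; auto. apply le_INR in Hmn.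
    apply Rle_trans with (1 := Lx). apply Rplus_le_compat_l, Rinv_le_contravar; [|lra].
    pose proof (pos_INR m). lra.
  - intros n x [_ Lx]. apply Rle_trans with (1 := Lx).
    rewrite <- Rinv_1 at 2. apply Rplus_le_compat_l, Rinv_le_contravar; [lra|].
    pose proof (pos_INR n). lra.
  - assert (Cv : closure C v).
    { apply closure_closure. eapply closure_mono; [|apply (Hv 0%nat)]. intros s [? ?]; auto. }
    assert (Nv : nsq v <= d).
    { apply Rnot_lt_le. intros Lt.
      destruct (inv_INR_small (nsq v - d)) as [N HN]; [lra|]. specialize (HN N (le_n _)).
      assert (nsq v <= d + / (INR N + 1)); [|lra].
      eapply closure_ball; [|apply (Hv N)]. intros s [? ?]; auto. }
    exists v. split; auto. intros w Cw.
    assert (0 <= 2 * (hinner w v - nsq v)); [|lra].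
    apply le_of_affine_quadratic with (b := nsq (hsub w v)). intros t Ht.
    assert (Q : d <= nsq (hadd (hscal t w) (hscal (1 - t) v))).
    { apply L. exists (hadd (hscal t w) (hscal (1 - t) v)). split; auto.
      apply closure_convex; auto; [lra | apply closure_incl; auto]. }
    replace (nsq (hadd _ _)) with
      (nsq v + 2 * (hinner w v - nsq v) * t + nsq (hsub w v) * (t * t)) in Q by hring.
    lra.
Qed.

End Norms.

(** * Convex lower semicontinuous functions *)

Lemma Rbar_le_of_eps (a : Rbar) (b : R) :
  (forall eps, 0 < eps -> Rbar_le a (b + eps)) -> Rbar_le a b.
Proof.
  intros H. destruct a as [a| |]; simpl in *; auto.
  - apply le_epsilon. auto.
  - apply (H 1). lra.
Qed.

Section GammaZero.
Context {X : Hilbert}.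
Implicit Types (h : X -> Rbar) (x y p u : X).

Lemma lsc_closure h (a : R) x : Gamma0 h ->
  closure (fun s => Rbar_le (h s) a) x -> Rbar_le (h x) a.
Proof.
  intros [_ [L _]] H.
  assert (HU : forall n, exists s, Rbar_le (h s) a /\ hnorm (hsub x s) < / (INR n + 1)).
  { intros n. apply H, inv_INR_pos. }
  set (u := fun n => proj1_sig (constructive_indefinite_description _ (HU n))).
  assert (Hu : forall n, Rbar_le (h (u n)) a /\ hnorm (hsub x (u n)) < / (INR n + 1))
    by (intros n; exact (proj2_sig (constructive_indefinite_description _ (HU n)))).
  apply (L a u x); [apply Hu|].
  intros eps He. destruct (inv_INR_small eps He) as [N HN]. exists N. intros n Hn.
  apply Rle_lt_trans with (hnorm (hsub x (u n))).
  - apply hnorm_le. rewrite nsq_sub_sym. lra.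
  - eapply Rlt_trans; [apply Hu | auto].
Qed.

Lemma lsc_nbhd h (a : R) x : Gamma0 h -> Rbar_lt a (h x) ->
  exists eps, 0 < eps /\ forall s, hnorm (hsub x s) < eps -> Rbar_lt a (h s).
Proof.
  intros G H. apply NNPP. intros N.
  apply (Rbar_lt_not_le _ _ H), lsc_closure; auto. intros eps He.
  apply NNPP. intros N'. apply N. exists eps. split; auto.
  intros s Hs. apply Rbar_not_le_lt. intros L. apply N'. exists s. auto.
Qed.

Lemma convex_le h x y (a b t : R) : Gamma0 h -> 0 <= t <= 1 ->
  Rbar_le (h x) a -> Rbar_le (h y) b ->
  Rbar_le (h (hadd (hscal t x) (hscal (1 - t) y))) (t * a + (1 - t) * b).
Proof. intros [C _]. apply C. Qed.

Lemma sublevel_convex h (a : R) : Gamma0 h -> convex_set (fun x => Rbar_le (h x) a).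
Proof.
  intros G x y t Ht Hx Hy. replace a with (t * a + (1 - t) * a) by ring.
  apply convex_le; auto.
Qed.

Lemma not_m_infty h x : Gamma0 h -> h x <> m_infty.
Proof. intros [_ [_ [P _]]]. apply P. Qed.

Lemma dom_finite h x : Gamma0 h -> dom h x -> exists r : R, h x = r.
Proof.
  intros G D. pose proof (not_m_infty h x G). unfold dom in D.
  destruct (h x) as [r| |]; try congruence. exists r. auto.
Qed.

Lemma le_dom h x (a : R) : Rbar_le (h x) a -> dom h x.
Proof. intros H E. rewrite E in H. exact H. Qed.

Lemma convex_shift_ball x0 x y t : 0 <= t <= 1 ->
  nsq (hsub (hadd (hscal t x) (hscal (1 - t) y)) x0)
  <= t * nsq (hsub x x0) + (1 - t) * nsq (hsub y x0).
Proof.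
  intros Ht.
  replace (hsub _ x0) with (hadd (hscal t (hsub x x0)) (hscal (1 - t) (hsub y x0)))
    by hvec.
  apply nsq_convex; auto.
Qed.

(** Otherwise the nested convex sets [h <= - n] within the ball have a common closure point, where
    lower semicontinuity forces the value [m_infty]. *)
Lemma bounded_below_unit_ball h x0 : Gamma0 h ->
  exists m : R, forall x, nsq (hsub x x0) <= 1 -> Rbar_le m (h x).
Proof.
  intros G. apply NNPP. intros N.
  destruct (nested_closures (fun n x => nsq (hsub x x0) <= 1 /\ Rbar_le (h x) (- INR n))
    (2 + 2 * nsq x0)) as [c Hc].
  - intros n. apply NNPP. intros N'. apply N. exists (- INR n). intros x Hx.
    apply Rbar_lt_le, Rbar_not_le_lt. intros L. apply N'. exists x. auto.
  - intros n x y t Ht [Bx Lx] [By Ly]. split; [|apply sublevel_convex; auto].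
    eapply Rle_trans; [apply convex_shift_ball; auto|]. nra.
  - intros m n x Hmn [Bx Lx]. split; auto. eapply Rbar_le_trans; [apply Lx|].
    simpl. apply le_INR in Hmn. lra.
  - intros n x [Bx _]. pose proof (nsq_triangle x x0 hzero) as T.
    replace (hsub x hzero) with x in T by hvec.
    replace (hsub x0 hzero) with x0 in T by hvec. lra.
  - apply (not_m_infty h c G).
    assert (A : forall n, Rbar_le (h c) (- INR n)).
    { intros n. apply lsc_closure; auto. eapply closure_mono; [|apply (Hc n)].
      intros s [_ ?]. auto. }
    destruct (h c) as [r| |]; auto.
    + destruct (INR_archimed 1 (- r)) as [n Hn]; [lra|]. specialize (A n). simpl in A. lra.
    + destruct (A 0%nat).
Qed.

(** Convexity spreads the bound [m] from the unit ball to [X]: for [x] outside, the point of the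
    segment from [x0] to [x] at distance 1 from [x0] has value at least [m]. This takes the place of
    a continuous affine minorant. *)
Lemma norm_minorant h x0 : Gamma0 h -> dom h x0 ->
  exists al be : R, 0 <= be /\
    forall x (a : R), Rbar_le (h x) a -> al - be * hnorm (hsub x x0) <= a.
Proof.
  intros G D. destruct (dom_finite h x0 G D) as [c0 E0].
  destruct (bounded_below_unit_ball h x0 G) as [m Hm].
  assert (Hm0 : m <= c0).
  { assert (H := Hm x0). rewrite E0 in H. apply H.
    replace (nsq _) with 0 by hring. lra. }
  exists m, (c0 - m). split; [lra|]. intros x a Ha.
  pose proof (hnorm_ge0 (hsub x x0)) as P. pose proof (hnorm_sq (hsub x x0)) as S.
  set (r := hnorm (hsub x x0)) in *.
  destruct (Rle_lt_dec r 1) as [L|L].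
  - assert (m <= a); [|nra].
    apply (Rbar_le_trans m (h x) a); auto. apply Hm. nra.
  - assert (Ir : 0 < / r <= 1).
    { split; [apply Rinv_0_lt_compat; lra|]. rewrite <- Rinv_1. apply Rinv_le_contravar; lra. }
    assert (M : m <= / r * a + (1 - / r) * c0).
    { apply (Rbar_le_trans m (h (hadd (hscal (/ r) x) (hscal (1 - / r) x0)))
        (/ r * a + (1 - / r) * c0)).
      - apply Hm. right.
        transitivity (/ r * / r * nsq (hsub x x0)); [hring|].
        rewrite <- S. field. lra.
      - apply convex_le; auto; [lra|]. rewrite E0. simpl. lra. }
    apply Rmult_le_compat_l with (r := r) in M; [|lra].
    replace (r * (/ r * a + _)) with (a + (r - 1) * c0) in M by (field; lra). nra.
Qed.

(* [p] minimises [h + lam/2 |. - y|^2]. *)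
Lemma prox_exists h y (lam : R) : Gamma0 h -> 0 < lam ->
  exists p, subdiff h p (hscal lam (hsub y p)).
Proof.
  intros G Hl. destruct (proj2 (proj2 (proj2 G))) as [x0 D0].
  destruct (norm_minorant h x0 G D0) as [al [be [Hbe Hmin]]].
  (* Coercivity. The triangle inequality turns [lam / 2 |x - y|^2] into [lam / 4 |x - x0|^2] minus a
     constant; one half of that absorbs the linear term [be * |x - x0|] at the cost [2 be^2 / lam],
     the other half remains. *)
  assert (Low : forall x (a : R), Rbar_le (h x) a ->
    lam / 8 * nsq (hsub x x0) + al - lam / 2 * nsq (hsub y x0) - 2 * be * be / lam
      <= a + lam / 2 * nsq (hsub x y)).
  { intros x a Ha. specialize (Hmin x a Ha).
    pose proof (nsq_triangle x y x0) as T.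
    pose proof (hnorm_sq (hsub x x0)) as S. set (r := hnorm (hsub x x0)) in *.
    assert (0 <= lam / 8 * (r - 4 * be / lam) * (r - 4 * be / lam)).
    { rewrite Rmult_assoc. apply Rmult_le_pos; [lra|]. apply Rle_0_sqr. }
    replace (lam / 8 * (r - 4 * be / lam) * (r - 4 * be / lam))
      with (lam / 8 * (r * r) - be * r + 2 * be * be / lam) in H by (field; lra).
    nra. }
  set (K := al - lam / 2 * nsq (hsub y x0) - 2 * be * be / lam) in *.
  destruct (infimum (fun r => exists x (a : R), Rbar_le (h x) a /\
      r = a + lam / 2 * nsq (hsub x y)) K) as [d [L A]].
  { destruct (dom_finite h x0 G D0) as [c0 E0].
    exists (c0 + lam / 2 * nsq (hsub x0 y)), x0, c0. rewrite E0. split; simpl; auto. lra. }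
  { intros r [x [a [Ha ->]]]. specialize (Low x a Ha). pose proof (nsq_ge0 (hsub x x0)).
    assert (0 <= lam / 8 * nsq (hsub x x0)) by nra. unfold K. lra. }
  set (B := 8 / lam * (d + 1 - K)).
  destruct (nested_closures (fun n x => Rbar_le (h x)
      (d + / (INR n + 1) - lam / 2 * nsq (hsub x y))) (2 * B + 2 * nsq x0)) as [p Hp].
  - intros n. destruct (A _ (inv_INR_pos n)) as [r [[x [a [Ha ->]]] Lr]].
    exists x. eapply Rbar_le_trans; [apply Ha|]. simpl. lra.
  - intros n x x' t Ht Hx Hx'.
    eapply Rbar_le_trans; [apply (convex_le h x x' _ _ t G Ht Hx Hx')|]. simpl.
    pose proof (convex_shift_ball y x x' t Ht). nra.
  - intros m n x Hmn Hx. eapply Rbar_le_trans; [apply Hx|]. simpl.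
    apply le_INR in Hmn. pose proof (pos_INR m).
    assert (/ (INR n + 1) <= / (INR m + 1)) by (apply Rinv_le_contravar; lra). lra.
  - intros n x Hx. specialize (Low x _ Hx).
    pose proof (nsq_triangle x x0 hzero) as T.
    replace (hsub x hzero) with x in T by hvec.
    replace (hsub x0 hzero) with x0 in T by hvec.
    assert (/ (INR n + 1) <= 1).
    { rewrite <- Rinv_1. pose proof (pos_INR n). apply Rinv_le_contravar; lra. }
    assert (nsq (hsub x x0) <= B); [|lra].
    apply Rmult_le_reg_l with (lam / 8); [lra|].
    replace (lam / 8 * B) with (d + 1 - K) by (unfold B; field; lra). unfold K. lra.
  - assert (Hv : Rbar_le (h p) (d - lam / 2 * nsq (hsub p y))).
    (* The bound on [h] in the nested sets varies with the point, so lower semicontinuity is applied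
       at a fixed level, after replacing [|s - y|^2] by [|p - y|^2] up to an error governed by
       [eps]. *)
    { apply Rbar_le_of_eps. intros eps He. apply lsc_closure; auto.
      apply closure_nsq. intros e1 He1.
      pose proof (nsq_ge0 (hsub p y)) as Pn.
      set (t := eps / (4 * lam * (nsq (hsub p y) + 1))).
      assert (Ht : 0 < t) by (apply Rdiv_lt_0_compat; nra).
      destruct (inv_INR_small (eps / 4)) as [N HN]; [lra|]. specialize (HN N (le_n _)).
      set (e2 := Rmin e1 (t * (eps / (4 * lam)))).
      assert (0 < eps / (4 * lam)) by (apply Rdiv_lt_0_compat; lra).
      assert (He2 : 0 < e2) by (apply Rmin_glb_lt; nra).
      destruct (proj1 (closure_nsq _ _) (Hp N) e2 He2) as [s [Hs Ls]].
      exists s. split; [|eapply Rlt_le_trans; [apply Ls | apply Rmin_l]].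
      eapply Rbar_le_trans; [apply Hs|]. simpl.
      pose proof (nsq_approx p s y t Ht) as Ap.
      assert (nsq (hsub p s) / t <= eps / (4 * lam)).
      { apply Rmult_le_reg_l with t; auto.
        replace (t * (nsq (hsub p s) / t)) with (nsq (hsub p s)) by (field; lra).
        apply Rlt_le. eapply Rlt_le_trans; [apply Ls | apply Rmin_r]. }
      assert (t * nsq (hsub p y) <= eps / (4 * lam)).
      { replace (eps / (4 * lam)) with (t * (nsq (hsub p y) + 1)) by (unfold t; field; lra).
        nra. }
      assert (lam * (eps / (4 * lam)) = eps / 4) by (field; lra).
      nra. }
    destruct (dom_finite h p G (le_dom _ _ _ Hv)) as [hp Ep].
    exists p, hp. split; auto. intros x. rewrite Ep in Hv. simpl in Hv.
    destruct (h x) as [hx| |] eqn:Ex; simpl; auto.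
    2: { exact (not_m_infty h x G Ex). }
    assert (0 <= hx - hp - lam * hinner (hsub y p) (hsub x p)).
    2: { revert H. hexpand. intros. lra. }
    apply le_of_affine_quadratic with (b := lam / 2 * nsq (hsub x p)).
    intros t Ht.
    assert (C : Rbar_le (h (hadd (hscal t x) (hscal (1 - t) p))) (t * hx + (1 - t) * hp)).
    { apply convex_le; auto; [lra| |]; rewrite ?Ex, ?Ep; simpl; lra. }
    assert (Q := L _ (ex_intro _ _ (ex_intro _ _ (conj C eq_refl)))).
    replace (nsq (hsub (hadd _ _) y)) with
      (nsq (hsub p y) - 2 * t * hinner (hsub y p) (hsub x p) + t * t * nsq (hsub x p))
      in Q by hring.
    lra.
Qed.

Lemma prox_subdiff h x : Gamma0 h -> subdiff h (prox h x) (hsub x (prox h x)).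
Proof.
  intros G. unfold prox.
  apply (epsilon_spec (inhabits hzero) (fun p => subdiff h p (hsub x p))).
  destruct (prox_exists h x 1 G) as [p Hp]; [lra|]. exists p.
  replace (hsub x p) with (hscal 1 (hsub x p)); auto. apply hscal_1.
Qed.

Lemma dom_subdiff_dom h x : dom_subdiff h x -> dom h x.
Proof. intros [u [r [E _]]]. unfold dom. rewrite E. discriminate. Qed.

Lemma subdiff_monotone h x u x' u' : subdiff h x u -> subdiff h x' u' ->
  0 <= hinner (hsub x x') (hsub u u').
Proof.
  intros [r [E S]] [r' [E' S']].
  specialize (S x'). specialize (S' x). rewrite E' in S. rewrite E in S'.
  revert S S'. simpl. hexpand. hsymm. intros. lra.
Qed.

(** The proximal points [p] of [x] with large weight [lam] approach [x], because [lam |x - p|^2 <= h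
    x - h p <= h x - al + be |p - x|]. *)
Lemma dom_in_closure_dom_subdiff h x : Gamma0 h -> dom h x -> closure (dom_subdiff h) x.
Proof.
  intros G D. destruct (norm_minorant h x G D) as [al [be [Hbe Hm]]].
  destruct (dom_finite h x G D) as [hx E].
  apply closure_nsq. intros eps He.
  set (M := Rabs (hx - al) + be * be + 1).
  assert (HM : 0 < M) by (unfold M; pose proof (Rabs_pos (hx - al)); nra).
  (* The extra [1] absorbs [be * r <= r^2 + be^2], leaving [(lam - 1) r^2 < M]. *)
  set (lam := M / eps + 1).
  assert (Hl : 0 < lam) by (unfold lam; assert (0 < M / eps) by (apply Rdiv_lt_0_compat; lra); lra).
  destruct (prox_exists h x lam G Hl) as [p Hp].
  exists p. split; [exists (hscal lam (hsub x p)); auto|].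
  destruct Hp as [hp [Ep Sp]]. specialize (Sp x). rewrite E in Sp. simpl in Sp.
  specialize (Hm p hp). rewrite Ep in Hm. specialize (Hm (Rle_refl _)).
  replace (hinner (hscal lam (hsub x p)) (hsub x p)) with (lam * nsq (hsub x p)) in Sp by hring.
  pose proof (hnorm_sq (hsub p x)) as S. rewrite (nsq_sub_sym p x) in S.
  set (r := hnorm (hsub p x)) in *. set (n := nsq (hsub x p)) in *.
  apply Rnot_le_lt. intros L.
  assert (lam * eps = M + eps) by (unfold lam; field; lra).
  pose proof (Rle_abs (hx - al)).
  assert (0 <= (r - be) * (r - be)) by apply Rle_0_sqr.
  assert (M + eps <= (lam - 1) * n + n).
  { assert (lam * eps <= lam * n) by nra. lra. }
  assert (M <= (lam - 1) * n).
  { replace M with ((lam - 1) * eps) by (unfold lam; field; lra).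
    assert (0 < M / eps) by (apply Rdiv_lt_0_compat; lra).
    apply Rmult_le_compat_l; auto. unfold lam. lra. }
  unfold M in *. nra.
Qed.

Lemma dom_fconj_iff h u : Gamma0 h ->
  dom (fconj h) u <-> exists F : R, forall x (a : R), h x = a -> hinner u x - a <= F.
Proof.
  intros G. unfold dom, fconj.
  destruct (Lub_Rbar_correct (fun r => exists x fx, h x = Finite fx /\ r = hinner u x - fx))
    as [U L].
  destruct (Lub_Rbar _) as [F| |].
  - split; [|discriminate]. intros _. exists F. intros x a Ea.
    apply (U (hinner u x - a)). exists x, a. auto.
  - split; [congruence|]. intros [F HF].
    destruct (L (Finite F)). intros r [x [fx [E ->]]]. simpl. auto.
  - split; [|discriminate]. intros _.
    destruct (proj2 (proj2 (proj2 G))) as [x0 D0].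
    destruct (dom_finite h x0 G D0) as [c0 E0].
    destruct (U (hinner u x0 - c0)). exists x0, c0. auto.
Qed.

(** The minimiser [p] of [h - <u, .> + lam / 2 |.|^2] has [u - lam p] as a subgradient. Since
    [h - <u, .>] is bounded below, [lam |p|^2] stays bounded, so [lam p] vanishes as [lam] tends to
    0. *)
Lemma dom_fconj_in_closure_ran h u : Gamma0 h ->
  dom (fconj h) u -> closure (ran_subdiff h) u.
Proof.
  intros G D. apply dom_fconj_iff in D; auto. destruct D as [F HF].
  destruct (proj2 (proj2 (proj2 G))) as [x0 D0].
  destruct (dom_finite h x0 G D0) as [c0 E0].
  apply closure_nsq. intros eps He.
  set (C := Rabs (c0 + F - hinner u x0)).
  pose proof (Rabs_pos (c0 + F - hinner u x0)) as PC. fold C in PC.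
  pose proof (Rle_abs (c0 + F - hinner u x0)) as LC. fold C in LC.
  pose proof (nsq_ge0 x0) as P0.
  set (lam := Rmin 1 (eps / (2 * (C + nsq x0 + 1)))).
  assert (0 < eps / (2 * (C + nsq x0 + 1))) by (apply Rdiv_lt_0_compat; lra).
  assert (Hl : 0 < lam <= 1).
  { split; [apply Rmin_glb_lt; lra | apply Rmin_l]. }
  assert (Hl2 : lam * (2 * (C + nsq x0 + 1)) <= eps).
  { apply Rle_trans with (eps / (2 * (C + nsq x0 + 1)) * (2 * (C + nsq x0 + 1)));
      [|right; field; lra].
    apply Rmult_le_compat_r; [lra | apply Rmin_r]. }
  destruct (prox_exists h (hscal (/ lam) u) lam G) as [p Hp]; [lra|].
  replace (hscal lam (hsub (hscal (/ lam) u) p)) with (hsub u (hscal lam p)) in Hp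
    by (hvec; field; lra).
  exists (hsub u (hscal lam p)). split; [exists p; auto|].
  replace (nsq _) with (lam * lam * nsq p) by hring.
  destruct Hp as [hp [Ep Sp]]. specialize (Sp x0). rewrite E0 in Sp. simpl in Sp.
  specialize (HF p hp Ep).
  pose proof (young p x0 1 ltac:(lra)) as Y.
  replace (hinner (hsub u (hscal lam p)) (hsub x0 p))
    with (hinner u x0 - hinner u p - lam * hinner p x0 + lam * nsq p) in Sp by hring.
  assert (lam * nsq p <= 2 * C + lam * nsq x0) by nra.
  assert (lam * (lam * nsq p) <= lam * (2 * C + lam * nsq x0)) by (apply Rmult_le_compat_l; lra).
  assert (0 <= lam * nsq x0 <= nsq x0) by nra.
  assert (lam * (lam * nsq x0) <= lam * nsq x0) by (apply Rmult_le_compat_l; lra).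
  lra.
Qed.

End GammaZero.

(** * Convex cluster points and weak convergence *)

Section Clusters.
Context {X : Hilbert}.
Implicit Types (s : nat -> X) (c z w : X) (I : nat -> Prop).

(** Encoded as the intersection of all convex supersets: a property passes to the hull as soon as it
    defines a convex set. *)
Definition hull (S : X -> Prop) (x : X) : Prop :=
  forall C : X -> Prop, convex_set C -> (forall y, S y -> C y) -> C x.

Definition infinite I : Prop := forall N, exists n, (N <= n)%nat /\ I n.

(* A substitute for weak cluster points of the subsequence indexed by [I]: these points
   form the closed convex hull of the weak cluster points. *)
Definition convex_cluster s I c : Prop :=
  forall N, closure (hull (fun x => exists n, (N <= n)%nat /\ I n /\ x = s n)) c.

Lemma ball_convex (B : R) : convex_set (fun x : X => nsq x <= B).
Proof.
  intros x y t Ht Hx Hy. eapply Rle_trans; [apply nsq_convex; auto|]. nra.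
Qed.

Lemma halfspace_convex w (b : R) : convex_set (fun x => b <= hinner x w).
Proof. intros x y t Ht Hx Hy. hexpand. nra. Qed.

Lemma convex_cluster_exists s I (B : R) :
  (forall n, nsq (s n) <= B) -> infinite I -> exists c, convex_cluster s I c.
Proof.
  intros HB HI.
  apply (nested_closures (fun N => hull (fun x => exists n, (N <= n)%nat /\ I n /\ x = s n)) B).
  - intros N. destruct (HI N) as [n [Hn In]]. exists (s n). intros C _ HC. apply HC. eauto.
  - intros N x y t Ht Hx Hy C CC HC. apply CC; [auto | apply Hx | apply Hy]; auto.
  - intros m n x Hmn Hx C CC HC. apply Hx; auto.
    intros y [j [Hj [Ij ->]]]. apply HC. exists j. repeat split; auto. lia.
  - intros N x Hx. apply (Hx (fun x => nsq x <= B)); [apply ball_convex|].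
    intros y [n [_ [_ ->]]]. auto.
Qed.

(** How cluster points are exploited: a convex constraint that holds eventually along [I] survives
    up to closure. *)
Lemma convex_cluster_closure s I c (C : X -> Prop) N :
  convex_cluster s I c -> convex_set C -> (forall n, (N <= n)%nat -> I n -> C (s n)) ->
  closure C c.
Proof.
  intros Hc CC H. eapply closure_mono; [|apply (Hc N)].
  intros x Hx. apply Hx; auto. intros y [n [Hn [In ->]]]. auto.
Qed.

Lemma convex_cluster_ge s I c w (b : R) N :
  convex_cluster s I c -> (forall n, (N <= n)%nat -> I n -> b <= hinner (s n) w) ->
  b <= hinner c w.
Proof.
  intros Hc H. apply (closure_halfspace (fun x => b <= hinner x w)); auto.
  eapply convex_cluster_closure; eauto. apply halfspace_convex.
Qed.

Lemma is_lim_seq_eventually (u : nat -> R) (l eps : R) : is_lim_seq u l -> 0 < eps ->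
  exists N, forall n, (N <= n)%nat -> l - eps < u n < l + eps.
Proof.
  intros H He. apply is_lim_seq_spec in H. destruct (H (mkposreal eps He)) as [N HN].
  exists N. intros n Hn. specialize (HN n Hn). simpl in HN. apply Rabs_lt_between in HN. lra.
Qed.

Lemma convex_cluster_lim s I c w (l : R) :
  convex_cluster s I c -> is_lim_seq (fun n => hinner (s n) w) l -> hinner c w = l.
Proof.
  intros Hc Hl. apply Rle_antisym; apply le_epsilon; intros eps He;
    destruct (is_lim_seq_eventually _ _ eps Hl He) as [N HN].
  - assert (- (l + eps) <= hinner c (hopp w)).
    { apply (convex_cluster_ge s I c _ _ N Hc). intros n Hn _. specialize (HN n Hn).
      rewrite hinner_opp_r. lra. }
    rewrite hinner_opp_r in H. lra.
  - assert (l - eps <= hinner c w); [|lra].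
    apply (convex_cluster_ge s I c _ _ N Hc). intros n Hn _. specialize (HN n Hn). lra.
Qed.

Lemma weak_cvg_convex_cluster s I c z :
  weak_cvg s z -> convex_cluster s I c -> c = z.
Proof. intros W Hc. apply hilbert_ext. intros w. eapply convex_cluster_lim; eauto. Qed.

Lemma not_infinite I : ~ infinite I -> exists N, forall n, (N <= n)%nat -> ~ I n.
Proof.
  intros H. apply NNPP. intros N. apply H. intros m. apply NNPP. intros N'.
  apply N. exists m. intros n Hn In. apply N'. eauto.
Qed.

(** If infinitely many indices violated the limit along some [w], that subsequence would have a
    cluster point in the half-space [<., w> >= <z, w> + eps], which excludes [z]. Hence the index
    set [I] in the notion of cluster point. *)
Lemma weak_cvg_of_unique_cluster s z (B : R) :
  (forall n, nsq (s n) <= B) ->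
  (forall I c, infinite I -> convex_cluster s I c -> c = z) -> weak_cvg s z.
Proof.
  intros HB U.
  assert (H : forall w eps, 0 < eps -> exists N, forall n, (N <= n)%nat ->
    hinner (s n) w < hinner z w + eps).
  { intros w eps He.
    destruct (not_infinite (fun n => hinner z w + eps <= hinner (s n) w)) as [N HN].
    - intros HI. destruct (convex_cluster_exists s _ B HB HI) as [c Hc].
      assert (E := U _ c HI Hc). subst c.
      assert (hinner z w + eps <= hinner z w); [|lra].
      apply (convex_cluster_ge s _ z w _ 0%nat Hc). auto.
    - exists N. intros n Hn. apply Rnot_le_lt. auto. }
  intros w. apply is_lim_seq_spec. intros [eps He]. simpl.
  destruct (H w eps He) as [N1 H1]. destruct (H (hopp w) eps He) as [N2 H2].
  exists (max N1 N2). intros n Hn.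
  specialize (H1 n ltac:(lia)). specialize (H2 n ltac:(lia)).
  rewrite !hinner_opp_r in H2. apply Rabs_lt_between. lra.
Qed.

(** Sublevel sets are closed and convex, so infinitely many terms with value at most [a] would force
    [h z <= a]. *)
Lemma weak_lsc (h : X -> Rbar) s z (B a : R) : Gamma0 h ->
  (forall n, nsq (s n) <= B) -> weak_cvg s z -> Rbar_lt a (h z) ->
  exists N, forall n, (N <= n)%nat -> Rbar_lt a (h (s n)).
Proof.
  intros G HB W Ha.
  destruct (not_infinite (fun n => Rbar_le (h (s n)) a)) as [N HN].
  - intros HI. destruct (convex_cluster_exists s _ B HB HI) as [c Hc].
    assert (E := weak_cvg_convex_cluster s _ c z W Hc). subst c.
    apply (Rbar_lt_not_le _ _ Ha), lsc_closure; auto.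
    apply (convex_cluster_closure s _ z _ 0%nat Hc); auto. apply sublevel_convex; auto.
  - exists N. intros n Hn. apply Rbar_not_le_lt. auto.
Qed.

Lemma bounded_mul_null s (d : nat -> X) (B : R) :
  (forall n, nsq (s n) <= B) -> is_lim_seq (fun n => nsq (d n)) 0 ->
  is_lim_seq (fun n => hinner (s n) (d n)) 0.
Proof.
  intros HB Hd.
  assert (Hn : is_lim_seq (fun n => sqrt B * hnorm (d n)) 0).
  { replace (Finite 0) with (Rbar_mult (sqrt B) (Finite (sqrt 0)))
      by (simpl; rewrite sqrt_0, Rmult_0_r; reflexivity).
    apply is_lim_seq_scal_l.
    apply (is_lim_seq_continuous sqrt (fun n => nsq (d n)) 0); auto.
    apply continuity_pt_sqrt. lra. }
  apply is_lim_seq_abs_0.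
  apply is_lim_seq_le_le with (fun _ => 0) (fun n => sqrt B * hnorm (d n));
    auto using is_lim_seq_const.
  intros n. split; [apply Rabs_pos|]. eapply Rle_trans; [apply cauchy_schwarz|].
  apply Rmult_le_compat_r; [apply hnorm_ge0|]. apply sqrt_le_1_alt, HB.
Qed.

End Clusters.

(** * The minimal displacement vector *)

Section Displacement.
Context {X : Hilbert}.
Implicit Types (f g : X -> Rbar) (a b v : X).

Lemma closure_hadd (A B : X -> Prop) a b : closure A a -> closure B b ->
  closure (fun w => exists a b, A a /\ B b /\ w = hadd a b) (hadd a b).
Proof.
  rewrite !closure_nsq. intros HA HB eps He.
  destruct (HA (eps / 4)) as [a' [Aa La]]; [lra|].
  destruct (HB (eps / 4)) as [b' [Bb Lb]]; [lra|].
  exists (hadd a' b'). split; [eauto|].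
  pose proof (nsq_hadd_hsub_le a b a' b'). lra.
Qed.

Lemma closure_hsub (A B : X -> Prop) a b : closure A a -> closure B b ->
  closure (fun w => exists a b, A a /\ B b /\ w = hsub a b) (hsub a b).
Proof.
  rewrite !closure_nsq. intros HA HB eps He.
  destruct (HA (eps / 4)) as [a' [Aa La]]; [lra|].
  destruct (HB (eps / 4)) as [b' [Bb Lb]]; [lra|].
  exists (hsub a' b'). split; [eauto|].
  pose proof (nsq_ge0 (hadd (hsub a a') (hsub b b'))) as P.
  revert P La Lb. hexpand. hsymm. intros. lra.
Qed.

Lemma dom_convex f x y t : Gamma0 f -> 0 <= t <= 1 -> dom f x -> dom f y ->
  dom f (hadd (hscal t x) (hscal (1 - t) y)).
Proof.
  intros G Ht Dx Dy. destruct (dom_finite f x G Dx) as [a Ea].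
  destruct (dom_finite f y G Dy) as [b Eb].
  apply le_dom with (t * a + (1 - t) * b). apply convex_le; auto.
  - rewrite Ea. apply Rbar_le_refl.
  - rewrite Eb. apply Rbar_le_refl.
Qed.

(* The point [v0] of least norm in the closure of [dom f - dom g] satisfies
   [b + v0 \in dom g^*] whenever [b \in dom g^*], so it lies in both closures
   and must be the displacement vector. *)
Lemma displacement_variational f g v : Gamma0 f -> Gamma0 g ->
  (exists a b, dom (fconj f) a /\ dom (fconj g) b /\ hadd a b = hzero) ->
  (forall w,
     closure (fun w => exists a b, dom_subdiff f a /\ dom_subdiff g b /\ w = hsub a b) w ->
     closure (fun w => exists a b, ran_subdiff f a /\ ran_subdiff g b /\ w = hadd a b) w ->
     nsq v <= nsq w) ->
  closure (fun w => exists a b, dom_subdiff f a /\ dom_subdiff g b /\ w = hsub a b) v ->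
  forall a b, dom f a -> dom g b -> nsq v <= hinner (hsub a b) v.
Proof.
  intros Gf Gg [fa [gb [Dfa [Dgb Eab]]]] Hmin Hv.
  set (E := fun w => exists a b, dom f a /\ dom g b /\ w = hsub a b).
  destruct (min_norm E) as [v0 [Cv0 Iv0]].
  - intros x y t Ht [a [b [Da [Db ->]]]] [a' [b' [Da' [Db' ->]]]].
    exists (hadd (hscal t a) (hscal (1 - t) a')), (hadd (hscal t b) (hscal (1 - t) b')).
    split; [apply dom_convex; auto|]. split; [apply dom_convex; auto|]. hvec.
  - destruct (proj2 (proj2 (proj2 Gf))) as [a Da]. destruct (proj2 (proj2 (proj2 Gg))) as [b Db].
    exists (hsub a b), a, b. auto.
  - assert (I : forall a b, dom f a -> dom g b -> nsq v0 <= hinner (hsub a b) v0).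
    { intros a b Da Db. apply Iv0. exists a, b. auto. }
    assert (V : v = v0); [|subst; auto].
    assert (L1 : nsq v <= nsq v0).
    { apply Hmin.
      - apply closure_closure. eapply closure_mono; [|apply Cv0].
        intros w [a [b [Da [Db ->]]]].
        apply closure_hsub; apply dom_in_closure_dom_subdiff; auto.
      - replace v0 with (hadd fa (hadd gb v0)).
        2: { rewrite hadd_assoc, Eab, hadd_comm. apply hadd_0. }
        apply closure_hadd; apply dom_fconj_in_closure_ran; auto.
        apply dom_fconj_iff in Dgb; auto. apply dom_fconj_iff; auto.
        destruct Dgb as [F HF]. destruct (proj2 (proj2 (proj2 Gf))) as [a Da].
        (* With [a] fixed in [dom f], the inequality for [v0] gives [<b, v0> <= <a, v0>] on all of
           [dom g]. *)
        exists (F + hinner a v0). intros b r Er. specialize (HF b r Er).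
        assert (Db : dom g b) by (unfold dom; rewrite Er; discriminate).
        specialize (I a b Da Db). pose proof (nsq_ge0 v0) as P. revert HF I P.
        hexpand. hsymm. intros. lra. }
    assert (L2 : nsq v0 <= hinner v v0).
    { apply (closure_halfspace E); auto.
      eapply closure_mono; [|apply Hv]. intros w [a [b [Da [Db ->]]]].
      exists a, b. repeat split; apply dom_subdiff_dom; auto. }
    (* [|v - v0|^2 = |v|^2 - 2 <v, v0> + |v0|^2] is at most 0 by [L1] and [L2]. *)
    apply eq_of_nsq_hsub_le0. revert L1 L2. hexpand. hsymm. intros. lra.
Qed.

End Displacement.

(** * Shadow sequences *)

Section Step.
Context {X : Hilbert}.
Variables (f g : X -> Rbar) (v : X).
Hypothesis VI : forall a b, dom f a -> dom g b -> nsq v <= hinner (hsub a b) v.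

(** Kuhn-Tucker pairs of the shifted problem: a primal solution with a dual one. *)
Definition solution_pair (z u : X) : Prop := subdiff f z u /\ subdiff g (hsub z v) (hopp u).

Lemma subdiff_dom (h : X -> Rbar) x u : subdiff h x u -> dom h x.
Proof. intros H. apply dom_subdiff_dom. exists u. auto. Qed.

Lemma shadow_side z p : dom f p -> dom g (hsub z v) -> 0 <= hinner (hsub p z) v.
Proof. intros Dp Dz. pose proof (VI _ _ Dp Dz) as H. revert H. hexpand. intros. lra. Qed.

Lemma shadow_side_g z q : dom f z -> dom g q -> 0 <= hinner (hsub (hsub z v) q) v.
Proof. intros Dz Dq. pose proof (VI _ _ Dz Dq) as H. revert H. hexpand. intros. lra. Qed.

(** With [e = p - z] and [h = k - u], monotonicity of the two subdifferentials becomes [0 <= <e, h>]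
    and [0 <= <e - d, d - h>] once the terms in [v] are dropped by sign. Together they give
    [<e + h, d> >= |d|^2], hence the first estimate; the second follows from [0 <= <e, h>] alone. *)
Lemma step_fejer (t : R) (z u p k d : X) : 0 <= t -> solution_pair z u ->
  subdiff f p (hsub k (hscal t v)) ->
  subdiff g (hsub (hsub p v) d) (hadd (hsub (hadd v d) k) (hscal t v)) ->
  nsq (hsub (hsub (hadd p k) d) (hadd z u)) + nsq d <= nsq (hsub (hadd p k) (hadd z u)) /\
  nsq (hsub p z) + nsq (hsub k u) <= nsq (hsub (hadd p k) (hadd z u)).
Proof.
  intros Ht [Sz Sz'] Sp Sq.
  pose proof (shadow_side z p (subdiff_dom _ _ _ Sp) (subdiff_dom _ _ _ Sz')) as V1.
  pose proof (shadow_side_g z _ (subdiff_dom _ _ _ Sz) (subdiff_dom _ _ _ Sq)) as V2.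
  pose proof (subdiff_monotone _ _ _ _ _ Sp Sz) as M1.
  pose proof (subdiff_monotone _ _ _ _ _ Sq Sz') as M2.
  assert (V1t : 0 <= t * hinner (hsub p z) v) by (apply Rmult_le_pos; auto).
  assert (V2t : 0 <= (t + 1) * hinner (hsub (hsub z v) (hsub (hsub p v) d)) v)
    by (apply Rmult_le_pos; lra).
  assert (E1 : 0 <= hinner (hsub p z) (hsub k u)).
  { revert M1 V1t. hexpand. hsymm. intros. lra. }
  assert (E2 : 0 <= hinner (hsub (hsub p z) d) (hsub d (hsub k u))).
  { revert M2 V2t. hexpand. hsymm. intros. lra. }
  clear - E1 E2.
  set (e := hsub p z) in *. set (h := hsub k u) in *.
  replace (hsub (hsub (hadd p k) d) (hadd z u)) with (hsub (hadd e h) d)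
    by (unfold e, h; hvec).
  replace (hsub (hadd p k) (hadd z u)) with (hadd e h) by (unfold e, h; hvec).
  clearbody e h. revert E1 E2. hexpand. hsymm. intros. lra.
Qed.

End Step.

(** * Asymptotics of the shadow sequences *)

Section Shadows.
Context {X : Hilbert}.
Variables (f g : X -> Rbar) (v : X) (z0 u0 : X) (f0 g0 : R) (p k d : nat -> X).
Hypothesis Gf : Gamma0 f.
Hypothesis Gg : Gamma0 g.
Hypothesis VI : forall a b, dom f a -> dom g b -> nsq v <= hinner (hsub a b) v.
Hypothesis S0 : solution_pair f g v z0 u0.
Hypothesis Ef0 : f z0 = f0.
Hypothesis Eg0 : g (hsub z0 v) = g0.
Let q n := hsub (hsub (p n) v) (d n).
Hypothesis Hf : forall n, subdiff f (p n) (hsub (k n) (hscal (INR n) v)).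
Hypothesis Hg : forall n,
  subdiff g (q n) (hadd (hsub (hadd v (d n)) (k n)) (hscal (INR n) v)).
Hypothesis Hstep : forall n, hadd (p (S n)) (k (S n)) = hsub (hadd (p n) (k n)) (d n).

Lemma fejer_limit z u : solution_pair f g v z u ->
  ex_finite_lim_seq (fun n => nsq (hsub (hadd (p n) (k n)) (hadd z u))).
Proof.
  intros S. apply ex_finite_lim_seq_decr with 0.
  - intros n. rewrite Hstep.
    destruct (step_fejer f g v VI (INR n) z u (p n) (k n) (d n) (pos_INR n) S (Hf n) (Hg n))
      as [H _].
    pose proof (nsq_ge0 (d n)). lra.
  - intros n. apply nsq_ge0.
Qed.

(** [|d n|^2] is bounded by the decrements of a convergent sequence. *)
Lemma d_null : is_lim_seq (fun n => nsq (d n)) 0.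
Proof.
  destruct (fejer_limit z0 u0 S0) as [l Hl].
  apply is_lim_seq_le_le with (fun _ => 0)
    (fun n => nsq (hsub (hadd (p n) (k n)) (hadd z0 u0))
              - nsq (hsub (hadd (p (S n)) (k (S n))) (hadd z0 u0))).
  - intros n. split; [apply nsq_ge0|]. rewrite Hstep.
    destruct (step_fejer f g v VI (INR n) z0 u0 (p n) (k n) (d n) (pos_INR n) S0 (Hf n) (Hg n))
      as [H _]. lra.
  - apply is_lim_seq_const.
  - replace (Finite 0) with (Finite (l - l)) by (f_equal; ring).
    apply is_lim_seq_minus'; auto.
    apply (is_lim_seq_incr_1 (fun n => nsq (hsub (hadd (p n) (k n)) (hadd z0 u0)))). auto.
Qed.

Lemma shadows_bounded : exists B, forall n, nsq (p n) <= B /\ nsq (k n) <= B.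
Proof.
  set (M := nsq (hsub (hadd (p 0%nat) (k 0%nat)) (hadd z0 u0))).
  assert (HM : forall n, nsq (hsub (hadd (p n) (k n)) (hadd z0 u0)) <= M).
  { induction n as [|n IH]; [apply Rle_refl|]. rewrite Hstep.
    destruct (step_fejer f g v VI (INR n) z0 u0 (p n) (k n) (d n) (pos_INR n) S0 (Hf n) (Hg n))
      as [H _]. pose proof (nsq_ge0 (d n)). lra. }
  exists (2 * M + 2 * nsq z0 + 2 * nsq u0). intros n.
  destruct (step_fejer f g v VI (INR n) z0 u0 (p n) (k n) (d n) (pos_INR n) S0 (Hf n) (Hg n))
    as [_ H].
  specialize (HM n).
  pose proof (nsq_ge0 z0). pose proof (nsq_ge0 u0).
  pose proof (nsq_ge0 (hsub (p n) z0)). pose proof (nsq_ge0 (hsub (k n) u0)).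
  pose proof (nsq_triangle (p n) z0 hzero) as T1.
  pose proof (nsq_triangle (k n) u0 hzero) as T2.
  assert (R0 : forall x : X, hsub x hzero = x) by (intros; hvec).
  rewrite !R0 in T1, T2. lra.
Qed.

Lemma null_inner (s : nat -> X) (B : R) : (forall n, nsq (s n) <= B) ->
  is_lim_seq (fun n => hinner (s n) (d n)) 0.
Proof. intros H. apply bounded_mul_null with B; auto. apply d_null. Qed.

Definition optimal (a : X) : Prop :=
  exists fa ga : R, f a = fa /\ g (hsub a v) = ga /\ fa + ga <= f0 + g0.

(** The subgradient inequalities at [z0] sum to an equality at [a], so each is tight there. The
    single dual solution [u0] therefore serves every primal one. *)
Lemma optimal_solution_pair a : optimal a -> solution_pair f g v a u0.
Proof.
  intros [fa [ga [Ea [Eb Le]]]].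
  destruct S0 as [[f0' [E0 Sf]] [g0' [E0' Sg]]].
  rewrite Ef0 in E0. rewrite Eg0 in E0'. injection E0 as <-. injection E0' as <-.
  pose proof (Sf a) as Ha. pose proof (Sg (hsub a v)) as Hb.
  rewrite Ea in Ha. rewrite Eb in Hb. simpl in Ha, Hb.
  split.
  - exists fa. split; auto. intros y. eapply Rbar_le_trans; [|apply Sf]. simpl.
    revert Ha Hb. hexpand. intros. lra.
  - exists ga. split; auto. intros y. eapply Rbar_le_trans; [|apply Sg]. simpl.
    revert Ha Hb. hexpand. intros. lra.
Qed.

Lemma subdiff_real (h : X -> Rbar) x u y (b : R) : subdiff h x u -> h y = b ->
  real (h x) + hinner u (hsub y x) <= b.
Proof. intros [r [E S]] Ey. specialize (S y). rewrite Ey in S. rewrite E. exact S. Qed.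

Lemma subdiff_finite (h : X -> Rbar) x u : subdiff h x u -> h x = Finite (real (h x)).
Proof. intros [r [E _]]. rewrite E. reflexivity. Qed.

Let phi n := real (f (p n)).
Let gam n := real (g (q n)).
(** Collects the terms containing [d n] in the subgradient inequality of [g] at
    [q n = p n - v - d n]. *)
Let err (a : X) n := hinner (k n) (d n) - hinner (hadd (hsub a (p n)) (d n)) (d n).

Lemma err_null a : is_lim_seq (err a) 0.
Proof.
  destruct shadows_bounded as [B HB].
  replace (Finite 0) with (Finite (0 - (0 + 0))) by (f_equal; ring).
  apply is_lim_seq_minus'.
  - apply null_inner with B. apply HB.
  - apply is_lim_seq_ext with (fun n => hinner (hsub a (p n)) (d n) + nsq (d n)).
    { intros n. hexpand. ring. }
    apply is_lim_seq_plus'; [|apply d_null].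
    apply null_inner with (2 * nsq a + 2 * B). intros n. destruct (HB n) as [Hp _].
    pose proof (nsq_ge0 (hadd a (p n))) as P. revert P Hp. hexpand. hsymm. intros. lra.
Qed.

Lemma f_value_bound a (fa : R) n : optimal a -> f a = fa ->
  hinner (k n) (hsub a (p n)) <= fa - phi n.
Proof.
  intros O Ea. destruct (optimal_solution_pair a O) as [_ Sg].
  pose proof (subdiff_real _ _ _ a fa (Hf n) Ea) as H. fold (phi n) in H.
  pose proof (shadow_side f g v VI a (p n) (subdiff_dom _ _ _ (Hf n)) (subdiff_dom _ _ _ Sg))
    as V.
  apply Rmult_le_compat_l with (r := INR n) in V; [|apply pos_INR].
  revert H V. hexpand. hsymm. intros. lra.
Qed.

Lemma g_value_bound a (ga : R) n : optimal a -> g (hsub a v) = ga ->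
  - hinner (k n) (hsub a (p n)) - err a n <= ga - gam n.
Proof.
  intros O Ea. destruct (optimal_solution_pair a O) as [Sf _].
  pose proof (subdiff_real _ _ _ (hsub a v) ga (Hg n) Ea) as H. fold (gam n) in H.
  pose proof (shadow_side_g f g v VI a (q n) (subdiff_dom _ _ _ Sf) (subdiff_dom _ _ _ (Hg n)))
    as V.
  apply Rmult_le_compat_l with (r := INR n + 1) in V; [|pose proof (pos_INR n); lra].
  unfold err, q in *. revert H V. hexpand. hsymm. intros. lra.
Qed.

Lemma optimal_z0 : optimal z0.
Proof. exists f0, g0. repeat split; auto. lra. Qed.

Lemma value_lower_bound n : f0 + g0 + hinner u0 (d n) <= phi n + gam n.
Proof.
  destruct S0 as [Sf Sg].
  pose proof (subdiff_real f z0 u0 (p n) (phi n) Sf (subdiff_finite _ _ _ (Hf n))) as H1.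
  pose proof (subdiff_real g _ _ (q n) (gam n) Sg (subdiff_finite _ _ _ (Hg n))) as H2.
  rewrite Ef0 in H1. rewrite Eg0 in H2. simpl in H1, H2.
  unfold q in H2. revert H1 H2. hexpand. intros. lra.
Qed.

Lemma u0_d_null : is_lim_seq (fun n => hinner u0 (d n)) 0.
Proof. apply null_inner with (nsq u0). intros _. apply Rle_refl. Qed.

(** For the upper bound, [<k n, z0 - p n>] cancels when the two bounds at [z0] are added. *)
Lemma values_cvg : is_lim_seq (fun n => phi n + gam n) (f0 + g0).
Proof.
  apply is_lim_seq_le_le with (fun n => f0 + g0 + hinner u0 (d n))
    (fun n => f0 + g0 + err z0 n).
  - intros n. split; [apply value_lower_bound|].
    pose proof (f_value_bound z0 f0 n optimal_z0 Ef0).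
    pose proof (g_value_bound z0 g0 n optimal_z0 Eg0). lra.
  - replace (Finite (f0 + g0)) with (Finite (f0 + g0 + 0)) by (f_equal; ring).
    apply is_lim_seq_plus'; [apply is_lim_seq_const | apply u0_d_null].
  - replace (Finite (f0 + g0)) with (Finite (f0 + g0 + 0)) by (f_equal; ring).
    apply is_lim_seq_plus'; [apply is_lim_seq_const | apply err_null].
Qed.

Lemma optimal_value a (fa ga : R) : optimal a -> f a = fa -> g (hsub a v) = ga ->
  fa + ga = f0 + g0.
Proof.
  intros [fa' [ga' [Ea [Eb Le]]]] Ea' Eb'.
  rewrite Ea in Ea'. rewrite Eb in Eb'. injection Ea' as ->. injection Eb' as ->.
  apply Rle_antisym; auto. destruct S0 as [Sf Sg].
  pose proof (subdiff_real f _ _ a fa Sf Ea) as H1.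
  pose proof (subdiff_real g _ _ _ ga Sg Eb) as H2.
  rewrite Ef0 in H1. rewrite Eg0 in H2. simpl in H1, H2.
  revert H1 H2. hexpand. intros. lra.
Qed.

(* Adding the bounds for [f] at [a] and for [g] at [b] squeezes
   [<k n, a - b>], because [f (p n) + g (q n)] converges to the optimal value. *)
Lemma dual_shadow_upper a b (fa fb : R) n : optimal a -> optimal b -> f a = fa -> f b = fb ->
  hinner (k n) (hsub a b) <= fa - fb - hinner u0 (d n) + err b n.
Proof.
  intros Oa Ob Ea Eb.
  assert (Ob' := Ob). destruct Ob' as [fb' [gb [Eb' [Ec _]]]].
  pose proof (optimal_value b fb gb Ob Eb Ec).
  pose proof (f_value_bound a fa n Oa Ea) as H1.
  pose proof (g_value_bound b gb n Ob Ec) as H2.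
  pose proof (value_lower_bound n) as H3.
  revert H1 H2. rewrite !hinner_sub_r. intros. lra.
Qed.

(** The lower half of the squeeze is the upper bound with [a] and [b] exchanged. *)
Lemma dual_shadow_cvg a b (fa fb : R) : optimal a -> optimal b -> f a = fa -> f b = fb ->
  is_lim_seq (fun n => hinner (k n) (hsub a b)) (fa - fb).
Proof.
  intros Oa Ob Ea Eb.
  apply is_lim_seq_le_le with (fun n => fa - fb + hinner u0 (d n) - err a n)
    (fun n => fa - fb - hinner u0 (d n) + err b n).
  - intros n. pose proof (dual_shadow_upper a b fa fb n Oa Ob Ea Eb).
    pose proof (dual_shadow_upper b a fb fa n Ob Oa Eb Ea) as H2.
    rewrite hinner_sub_r in *. lra.
  - replace (Finite (fa - fb)) with (Finite (fa - fb + 0 - 0)) by (f_equal; ring).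
    apply is_lim_seq_minus'; [|apply err_null].
    apply is_lim_seq_plus'; [apply is_lim_seq_const | apply u0_d_null].
  - replace (Finite (fa - fb)) with (Finite (fa - fb - 0 + 0)) by (f_equal; ring).
    apply is_lim_seq_plus'; [|apply err_null].
    apply is_lim_seq_minus'; [apply is_lim_seq_const | apply u0_d_null].
Qed.

Lemma primal_shadow_cvg a b : optimal a -> optimal b ->
  exists l : R, is_lim_seq (fun n => hinner (p n) (hsub a b)) l.
Proof.
  intros Oa Ob.
  destruct (fejer_limit a u0 (optimal_solution_pair a Oa)) as [la La].
  destruct (fejer_limit b u0 (optimal_solution_pair b Ob)) as [lb Lb].
  assert (Oa' := Oa). assert (Ob' := Ob).
  destruct Oa' as [fa [_ [Ea _]]]. destruct Ob' as [fb [_ [Eb _]]].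
  exists ((lb - la) * / 2 + (nsq (hadd a u0) - nsq (hadd b u0)) / 2 - (fa - fb)).
  apply is_lim_seq_ext with (fun n =>
    (nsq (hsub (hadd (p n) (k n)) (hadd b u0)) - nsq (hsub (hadd (p n) (k n)) (hadd a u0))) * / 2
    + (nsq (hadd a u0) - nsq (hadd b u0)) / 2 - hinner (k n) (hsub a b)).
  { intros n. hexpand. hsymm. field. }
  apply is_lim_seq_minus'; [|apply dual_shadow_cvg; auto].
  apply is_lim_seq_plus'; [|apply is_lim_seq_const].
  apply is_lim_seq_mult'; [apply is_lim_seq_minus'; auto | apply is_lim_seq_const].
Qed.

(** Values of [g] are known at [q n], not at [p n - v], so the sets [Q eps] quantify over a
    companion [y] near [x - v]; as projections of jointly convex sets they remain convex, and [c]
    lies in the closure of each. *)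
Lemma cluster_optimal I c : convex_cluster p I c -> optimal c.
Proof.
  intros Hc.
  set (Q := fun eps x => exists (y : X) (al be : R), Rbar_le (f x) al /\ Rbar_le (g y) be /\
    nsq (hsub (hsub x v) y) <= eps /\ al + be <= f0 + g0 + eps).
  assert (HQ : forall eps, 0 < eps -> closure (Q eps) c).
  { intros eps He.
    destruct (is_lim_seq_eventually _ _ eps values_cvg He) as [N1 H1].
    destruct (is_lim_seq_eventually _ _ eps d_null He) as [N2 H2].
    apply (convex_cluster_closure p I c (Q eps) (max N1 N2)); auto.
    - intros x x' t Ht [y [al [be [A1 [A2 [A3 A4]]]]]] [y' [al' [be' [B1 [B2 [B3 B4]]]]]].
      exists (hadd (hscal t y) (hscal (1 - t) y')),
        (t * al + (1 - t) * al'), (t * be + (1 - t) * be').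
      split; [apply convex_le; auto|]. split; [apply convex_le; auto|]. split; [|nra].
      replace (hsub _ _) with
        (hadd (hscal t (hsub (hsub x v) y)) (hscal (1 - t) (hsub (hsub x' v) y')))
        by hvec.
      eapply Rle_trans; [apply nsq_convex; auto|]. nra.
    - intros n Hn _. exists (q n), (phi n), (gam n).
      unfold phi, gam. rewrite <- (subdiff_finite _ _ _ (Hf n)), <- (subdiff_finite _ _ _ (Hg n)).
      split; [apply Rbar_le_refl|]. split; [apply Rbar_le_refl|]. split.
      + replace (hsub _ _) with (d n) by (unfold q; hvec).
        specialize (H2 n ltac:(lia)). lra.
      + specialize (H1 n ltac:(lia)). unfold phi, gam in H1. lra. }
  (* Real lower bounds [a] and [b] also cover infinite values: if [f c] or [g (c - v)] were
     [p_infty], some choice would violate [a + b <= f0 + g0]. *)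
  assert (Main : forall a b : R, Rbar_lt a (f c) -> Rbar_lt b (g (hsub c v)) -> a + b <= f0 + g0).
  { intros a b Ha Hb. apply le_epsilon. intros e He.
    destruct (lsc_nbhd f a c Gf Ha) as [ef [Pf Nf]].
    destruct (lsc_nbhd g b (hsub c v) Gg Hb) as [eg [Pg Ng]].
    set (eps := Rmin e (eg * eg / 8)).
    assert (He' : 0 < eps) by (apply Rmin_glb_lt; auto; nra).
    assert (E1 : eps <= e) by apply Rmin_l.
    assert (E2 : eps <= eg * eg / 8) by apply Rmin_r.
    set (r := Rmin (ef * ef) (eg * eg / 8)).
    assert (Hr : 0 < r) by (apply Rmin_glb_lt; nra).
    assert (R1 : r <= ef * ef) by apply Rmin_l.
    assert (R2 : r <= eg * eg / 8) by apply Rmin_r.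
    destruct (proj1 (closure_nsq _ _) (HQ eps He') r Hr)
      as [x [[y [al [be [A1 [A2 [A3 A4]]]]]] Lx]].
    assert (a < al).
    { apply (Rbar_lt_le_trans a (f x) al); auto. apply Nf, hnorm_lt; auto. lra. }
    assert (b < be).
    { apply (Rbar_lt_le_trans b (g y) be); auto. apply Ng, hnorm_lt; auto.
      pose proof (nsq_triangle (hsub c v) (hsub x v) y) as T.
      replace (hsub (hsub c v) (hsub x v)) with (hsub c x) in T by hvec. nra. }
    lra. }
  assert (Lo : forall (h : X -> Rbar) x, Gamma0 h -> exists a : R, Rbar_lt a (h x)).
  { intros h x G. pose proof (not_m_infty h x G). destruct (h x) as [r| |].
    - exists (r - 1). simpl. lra.
    - exists 0. simpl. auto.
    - congruence. }
  destruct (f c) as [fc| |] eqn:Ec; [| |destruct (not_m_infty f c Gf Ec)].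
  2: { destruct (Lo g (hsub c v) Gg) as [b Hb].
       specialize (Main (f0 + g0 - b + 1) b ltac:(simpl; auto) Hb). lra. }
  destruct (g (hsub c v)) as [gc| |] eqn:Ed; [| |destruct (not_m_infty g _ Gg Ed)].
  2: { specialize (Main (fc - 1) (f0 + g0 - fc + 2)). simpl in Main.
       assert (fc - 1 + (f0 + g0 - fc + 2) <= f0 + g0) by (apply Main; auto; lra). lra. }
  exists fc, gc. repeat split; auto. apply le_epsilon. intros e He.
  specialize (Main (fc - e / 2) (gc - e / 2)). simpl in Main.
  assert (fc - e / 2 + (gc - e / 2) <= f0 + g0) by (apply Main; lra). lra.
Qed.

Lemma shadows_weak_cvg : exists z, optimal z /\ weak_cvg p z /\ weak_cvg q (hsub z v).
Proof.
  destruct shadows_bounded as [B HB].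
  assert (HBp : forall n, nsq (p n) <= B) by apply HB.
  assert (Inf : infinite (fun _ => True)) by (intros N; exists N; auto).
  destruct (convex_cluster_exists p _ B HBp Inf) as [z Hz].
  assert (Oz := cluster_optimal _ _ Hz).
  assert (W : weak_cvg p z).
  { apply weak_cvg_of_unique_cluster with B; auto. intros I c _ Hc.
    assert (Oc := cluster_optimal _ _ Hc).
    (* Both cluster points inherit this limit, so [<c, c - z> = l = <z, c - z>]. *)
    destruct (primal_shadow_cvg c z Oc Oz) as [l Hl].
    pose proof (convex_cluster_lim _ _ _ _ _ Hc Hl) as E1.
    pose proof (convex_cluster_lim _ _ _ _ _ Hz Hl) as E2.
    apply eq_of_nsq_hsub_le0. unfold nsq. rewrite hinner_sub_l. lra. }
  exists z. split; [auto|]. split; [auto|]. intros w.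
  apply is_lim_seq_ext with (fun n => hinner (p n) w - hinner v w - hinner w (d n)).
  { intros n. unfold q. hexpand. hsymm. ring. }
  replace (Finite (hinner (hsub z v) w)) with (Finite (hinner z w - hinner v w - 0))
    by (f_equal; hexpand; ring).
  apply is_lim_seq_minus'; [|apply null_inner with (nsq w); intros; apply Rle_refl].
  apply is_lim_seq_minus'; [apply W | apply is_lim_seq_const].
Qed.

(** Weak lower semicontinuity bounds each value asymptotically from below; as the sum tends to
    [fz + gz], neither can stay above its target. *)
Lemma value_pair_cvg z (fz gz : R) : f z = fz -> g (hsub z v) = gz -> fz + gz = f0 + g0 ->
  weak_cvg p z -> weak_cvg q (hsub z v) ->
  is_lim_seq phi fz /\ is_lim_seq gam gz.
Proof.
  intros Ef Eg E Wp Wq.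
  destruct shadows_bounded as [B HB].
  assert (H : forall eps, 0 < eps -> exists N, forall n, (N <= n)%nat ->
    Rabs (phi n - fz) < eps /\ Rabs (gam n - gz) < eps).
  { intros eps He.
    destruct (is_lim_seq_eventually _ _ (eps / 2) values_cvg) as [N1 H1]; [lra|].
    destruct (is_lim_seq_eventually _ _ 1 d_null) as [N2 H2]; [lra|].
    destruct (weak_lsc f p z B (fz - eps / 2) Gf) as [N3 H3]; auto; [apply HB| |].
    { rewrite Ef. simpl. lra. }
    (* [weak_lsc] asks for a bound at every index, and [|d n|^2 < 1] is available only from [N2] on,
       hence the shift. *)
    destruct (weak_lsc g (fun n => q (n + N2)%nat) (hsub z v) (2 * (2 * B + 2 * nsq v) + 2)
      (gz - eps / 2) Gg) as [N4 H4].
    - intros n. specialize (H2 (n + N2)%nat ltac:(lia)). destruct (HB (n + N2)%nat) as [Hp _].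
      unfold q.
      pose proof (nsq_ge0 (hadd (p (n + N2)%nat) v)) as P1.
      pose proof (nsq_ge0 (hadd (hsub (p (n + N2)%nat) v) (d (n + N2)%nat))) as P2.
      destruct H2 as [_ H2]. revert P1 P2 Hp H2. hexpand. hsymm. intros. lra.
    - intros w. apply (is_lim_seq_incr_n (fun n => hinner (q n) w) N2). apply Wq.
    - rewrite Eg. simpl. lra.
    - exists (N1 + N3 + N4 + N2)%nat. intros n Hn.
      specialize (H1 n ltac:(lia)). specialize (H3 n ltac:(lia)).
      specialize (H4 (n - N2)%nat ltac:(lia)).
      replace (n - N2 + N2)%nat with n in H4 by lia.
      rewrite (subdiff_finite _ _ _ (Hf n)) in H3. rewrite (subdiff_finite _ _ _ (Hg n)) in H4.
      simpl in H3, H4. fold (phi n) in H3. fold (gam n) in H4.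
      split; apply Rabs_lt_between; lra. }
  split; apply is_lim_seq_spec; intros [eps He]; simpl;
    destruct (H eps He) as [N HN]; exists N; intros n Hn; apply HN; auto.
Qed.

End Shadows.

(** * Transfer to the iterates of [T] *)

Lemma is_lim_seq_Rbar_cvg (u : nat -> Rbar) (r : nat -> R) (l : R) :
  (forall n, u n = r n) -> is_lim_seq r l -> Rbar_cvg u l.
Proof.
  intros E H eps He. destruct (is_lim_seq_eventually _ _ eps H He) as [N HN].
  exists N. intros n Hn. exists (r n). split; auto.
  specialize (HN n Hn). apply Rabs_lt_between. lra.
Qed.

Theorem theorem6p9 (X : Hilbert) (f g : X -> Rbar) (v : X) (mu : Rbar) (x : X) :
  Gamma0 f -> Gamma0 g ->
  (* v := P_{cl ran(Id - T)}(0) *)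
  is_proj0 (closure (fun w => exists y, w = hsub y (Top f g y))) v ->
  (* cl ran(Id - T) = cl (D /\ R) = cl D /\ cl R *)
  (forall w,
     (closure (fun w => exists y, w = hsub y (Top f g y)) w <->
      closure (fun w => (exists a b, dom_subdiff f a /\ dom_subdiff g b /\ w = hsub a b) /\
                        (exists a b, ran_subdiff f a /\ ran_subdiff g b /\ w = hadd a b)) w) /\
     (closure (fun w => (exists a b, dom_subdiff f a /\ dom_subdiff g b /\ w = hsub a b) /\
                        (exists a b, ran_subdiff f a /\ ran_subdiff g b /\ w = hadd a b)) w <->
      closure (fun w => exists a b, dom_subdiff f a /\ dom_subdiff g b /\ w = hsub a b) w /\
      closure (fun w => exists a b, ran_subdiff f a /\ ran_subdiff g b /\ w = hadd a b) w)) ->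
  (* 0 in dom f* + dom g* *)
  (exists a b, dom (fconj f) a /\ dom (fconj g) b /\ hadd a b = hzero) ->
  (* v in ran(Id - T) *)
  (exists y, hsub y (Top f g y) = v) ->
  (* zer(df + dg(. - v)) nonempty *)
  (exists y a b, subdiff f y a /\ subdiff g (hsub y v) b /\ hadd a b = hzero) ->
  (* mu := min_y f(y) + g(y - v) *)
  (exists y, Rbar_plus (f y) (g (hsub y v)) = mu) ->
  (forall y, Rbar_le mu (Rbar_plus (f y) (g (hsub y v)))) ->
  exists zb : X,
    (* (i) *)
    weak_cvg (fun n => prox f (Nat.iter n (Top f g) x)) zb /\
    is_minimizer (fun y => Rbar_plus (f y) (g (hsub y v))) zb /\
    (* (ii) *)
    weak_cvg (fun n => prox g (refl f (Nat.iter n (Top f g) x))) (hsub zb v) /\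
    is_minimizer (fun y => Rbar_plus (f (hadd y v)) (g y)) (hsub zb v) /\
    (* (iii) *)
    Rbar_cvg (fun n => Rbar_plus (f (prox f (Nat.iter n (Top f g) x)))
                                  (g (prox g (refl f (Nat.iter n (Top f g) x)))))
              (Rbar_plus (f zb) (g (hsub zb v))) /\
    Rbar_plus (f zb) (g (hsub zb v)) = mu /\
    (* (iv) *)
    Rbar_cvg (fun n => f (prox f (Nat.iter n (Top f g) x)))
              (f zb) /\
    (* (v) *)
    Rbar_cvg (fun n => g (prox g (refl f (Nat.iter n (Top f g) x))))
              (g (hsub zb v)).
Proof.
  intros Gf Gg [Hv Hvmin] Hcl Hconj _ [z0 [u0 [u0' [Sf [Sg Hu]]]]] [ym Hym] Hmu.
  assert (VI : forall a b, dom f a -> dom g b -> nsq v <= hinner (hsub a b) v).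
  { apply displacement_variational; auto.
    - intros w H1 H2. apply hnorm_le, Hvmin. destruct (Hcl w) as [C1 C2].
      apply C1, C2. auto.
    - destruct (Hcl v) as [C1 C2]. apply C2, C1. auto. }
  assert (S0 : solution_pair f g v z0 u0).
  { split; auto. replace (hopp u0) with u0'; auto.
    apply hilbert_ext. intros w.
    assert (E : hinner (hadd u0 u0') w = hinner hzero w) by (rewrite Hu; reflexivity).
    revert E. hexpand. intros. lra. }
  destruct S0 as [Sf0 Sg0].
  assert (Ef0 := subdiff_finite f _ _ Sf0). assert (Eg0 := subdiff_finite g _ _ Sg0).
  set (f0 := real (f z0)) in *. set (g0 := real (g (hsub z0 v))) in *.
  set (xs := fun n => Nat.iter n (Top f g) x).
  set (p := fun n => prox f (xs n)).
  set (q := fun n => prox g (refl f (xs n))).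
  set (k := fun n => hsub (hadd (xs n) (hscal (INR n) v)) (p n)).
  set (d := fun n => hsub (hsub (p n) (q n)) v).
  assert (Eq : forall n, hsub (hsub (p n) v) (d n) = q n) by (intros; unfold d; hvec).
  assert (Hf : forall n, subdiff f (p n) (hsub (k n) (hscal (INR n) v))).
  { intros n. replace (hsub (k n) _) with (hsub (xs n) (p n)) by (unfold k; hvec).
    apply prox_subdiff; auto. }
  assert (Hg : forall n, subdiff g (hsub (hsub (p n) v) (d n))
    (hadd (hsub (hadd v (d n)) (k n)) (hscal (INR n) v))).
  { intros n. rewrite Eq.
    (* [R_f x_n - q_n = (p_n - q_n) - (x_n - p_n)], where [p_n - q_n = v + d_n] and
       [x_n - p_n = k_n - n v]. *)
    replace (hadd _ _) with (hsub (refl f (xs n)) (q n)).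
    - apply prox_subdiff; auto.
    - unfold d, k, refl. fold (p n). hvec. }
  (* One application of [T] subtracts [v + d_n]; passing from [n v] to [(n + 1) v] restores [v]. *)
  assert (Hstep : forall n, hadd (p (S n)) (k (S n)) = hsub (hadd (p n) (k n)) (d n)).
  { intros n.
    assert (E : xs (S n) = hadd (hsub (xs n) (p n)) (q n)) by reflexivity.
    unfold k, d. rewrite E, S_INR. hvec. }
  destruct (shadows_weak_cvg f g v z0 u0 f0 g0 p k d Gf Gg VI (conj Sf0 Sg0) Ef0 Eg0 Hf Hg Hstep)
    as [z [Oz [Wp Wq]]].
  destruct Oz as [fz [gz [Ef [Eg Le]]]].
  assert (Oz : optimal f g v f0 g0 z) by (exists fz, gz; auto).
  assert (Ev := optimal_value f g v z0 u0 f0 g0 (conj Sf0 Sg0) Ef0 Eg0 z fz gz Oz Ef Eg).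
  assert (Lmu : forall y, Rbar_le (f0 + g0) (Rbar_plus (f y) (g (hsub y v)))).
  { intros y. pose proof (not_m_infty f y Gf). pose proof (not_m_infty g (hsub y v) Gg).
    destruct (f y) as [fy| |] eqn:Efy; destruct (g (hsub y v)) as [gy| |] eqn:Egy;
      simpl; try congruence; auto.
    pose proof (subdiff_real f _ _ y fy Sf0 Efy) as H1.
    pose proof (subdiff_real g _ _ _ gy Sg0 Egy) as H2.
    fold f0 in H1. fold g0 in H2. revert H1 H2. hexpand. intros. lra. }
  assert (Emu : mu = Finite (f0 + g0)).
  { apply Rbar_le_antisym.
    - specialize (Hmu z0). rewrite Ef0, Eg0 in Hmu. exact Hmu.
    - rewrite <- Hym. apply Lmu. }
  destruct (value_pair_cvg f g v z0 u0 f0 g0 p k d Gf Gg VI (conj Sf0 Sg0) Ef0 Eg0 Hf Hg Hstep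
    z fz gz Ef Eg Ev Wp Wq) as [Cf Cg].
  assert (Vf : forall n, f (p n) = real (f (p n))).
  { intros n. eapply subdiff_finite, Hf. }
  assert (Vg : forall n, g (q n) = real (g (hsub (hsub (p n) v) (d n)))).
  { intros n. rewrite Eq, <- (Eq n). eapply subdiff_finite, Hg. }
  exists z. rewrite Ef, Eg.
  split; [exact Wp|]. split; [|split; [|split; [|split; [|split; [|split]]]]].
  - intros y. rewrite Ef, Eg. simpl. rewrite Ev. apply Lmu.
  - intros w. apply is_lim_seq_ext with (2 := Wq w). intros n. rewrite Eq. reflexivity.
  - intros y. replace (hadd (hsub z v) v) with z by hvec. rewrite Ef, Eg. simpl. rewrite Ev.
    specialize (Lmu (hadd y v)). replace (hsub (hadd y v) v) with y in Lmu by hvec. auto.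
  - apply is_lim_seq_Rbar_cvg with (fun n => real (f (p n)) +
      real (g (hsub (hsub (p n) v) (d n)))).
    + intros n. fold (xs n). fold (p n). fold (q n). rewrite Vg, Vf. reflexivity.
    + apply is_lim_seq_plus'; auto.
  - simpl. rewrite Ev. auto.
  - eapply is_lim_seq_Rbar_cvg; [exact Vf | exact Cf].
  - eapply is_lim_seq_Rbar_cvg; [exact Vg | exact Cg].
Qed.
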